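(* As $\varepsilon\to0$, the bit query complexity of approximating the smallest eigenvalue $\lambda(q)$, $q\in\mathbf{Q}$, satisfies $$n^{\text{bit-query}}(\varepsilon)=\Omega(\varepsilon^{-1/3}).$$
   Context: $\mathbf{Q}$ is the class of functions $q:[0,1]\to[0,1]$ with $q\in C^2([0,1])$ and $\max_{i=0,1,2}\max_{x\in[0,1]}|q^{(i)}(x)|\le 1$. For $q\in\mathbf{Q}$, $\lambda(q)$ is the smallest eigenvalue of $-u''+qu=\lambda u$ on $(0,1)$, $u(0)=u(1)=0$. Quantum algorithms with bit queries: let $\mathcal{H}_\nu=(\mathbb{C}^2)^{\otimes\nu}$. A bit query for $q$ is the unitary operator $Q_q$ on $\mathcal{H}_{m'}\otimes\mathcal{H}_{m''}$ (acting as the identity on further ancilla qubits, if any) given by $Q_q|j\rangle|k\rangle=|j\rangle|k\oplus\beta(q(\tau(j)))\rangle$, where $\tau:\{0,\dots,2^{m'}-1\}\to[0,1]$ and $\beta:[0,1]\to\{0,\dots,2^{m''}-1\}$ are fixed functions and $\oplus$ is addition modulo $2^{m''}$. An algorithm with $T$ bit queries on $\nu$ qubits computes $$|\psi\rangle=U_TQ_qU_{T-1}Q_q\cdots U_1Q_qU_0|\psi_0\rangle,$$ where the unit vector $|\psi_0\rangle\in\mathcal{H}_\nu$ and the unitaries $U_0,\dots,U_T$ do not depend on $q$. The final state is measured, producing outcome $j\in\{0,\dots,M-1\}$ ($M\le2^\nu$) with a probability $p_q(j)$, and from $j$ an approximation $\hat\lambda(j)$ to $\lambda(q)$ is computed classically;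 the queries are the only source of information about $q$. Classical computations can be simulated in this form, with classically computed function values corresponding to bit queries. The algorithm computes an $\varepsilon$-approximation with probability $\tfrac34$ if for every $q\in\mathbf{Q}$, $\sum_{j:\,|\lambda(q)-\hat\lambda(j)|\le\varepsilon}p_q(j)\ge\tfrac34$. $n^{\text{bit-query}}(\varepsilon)$ is the minimal number $T$ of bit queries for which such an algorithm (with any $\nu,m',m'',\tau,\beta$) exists. *)

(* Defs.v *)
From mathcomp Require Import all_boot all_order all_algebra.
From mathcomp Require Import spectral.
From mathcomp Require Import all_classical all_reals all_analysis.
From mathcomp Require Import complex mxtens.
Set Implicit Arguments.
Unset Strict Implicit.
Unset Printing Implicit Defensive.
Import Order.TTheory GRing.Theory Num.Theory.
Import numFieldNormedType.Exports.
Local Open Scope classical_set_scope.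
Local Open Scope ring_scope.
Local Open Scope sesquilinear_scope.

(* Functions on [0,1] are represented by functions R -> R whose values outside
   [0,1] play no role. *)

Section SturmLiouville.
Variable R : realType.
Implicit Types (f q u : R -> R) (x l : R).

(* One-sided at the endpoints 0 and 1. *)
Definition deriv01 f x l : Prop :=
  (f y - f x) / (y - x) @[y --> within `[0, 1] x^'] --> l.

Definition C2_01 f f1 f2 : Prop :=
  [/\ forall x, x \in `[0, 1] -> deriv01 f x (f1 x),
      forall x, x \in `[0, 1] -> deriv01 f1 x (f2 x)
    & {within `[0, 1], continuous f2}].

Definition class_Q : set (R -> R) :=
  [set q | (forall x, x \in `[0, 1] -> 0 <= q x <= 1) /\
    exists q1 q2, C2_01 q q1 q2 /\
      forall x, x \in `[0, 1] -> [/\ `|q x| <= 1, `|q1 x| <= 1 & `|q2 x| <= 1]].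

(* The problem is self-adjoint: its eigenvalues are real and have real
   eigenfunctions. *)
Definition sl_eigenvalue q : set R :=
  [set l | exists u u1 u2, [/\ C2_01 u u1 u2,
      exists2 x : R, x \in `[0, 1] & u x != 0,
      u 0 = 0 /\ u 1 = 0
    & forall x, x \in `]0, 1[ -> - u2 x + q x * u x = l * u x]].

Definition lambda q : R :=
  xget 0 [set l | sl_eigenvalue q l /\ lbound (sl_eigenvalue q) l].

End SturmLiouville.

Section BitQueries.
Variable R : realType.
Local Notation C := (complex R).

(* |j>|k> is the basis vector of index mxtens_index (j, k). *)
Definition bit_query (m' m'' : nat) (tau : 'I_(2 ^ m') -> R)
    (beta : R -> 'I_(2 ^ m'')) (q : R -> R) : 'M[C]_(2 ^ m' * 2 ^ m'') :=
  \matrix_(r, c)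
    let: (j', k') := mxtens_unindex r in
    let: (j, k) := mxtens_unindex c in
    ((j' == j) && (k' == (k + beta (q (tau j))) %% 2 ^ m'' :> nat)%N)%:R.

Definition psd n (A : 'M[C]_n) : Prop :=
  forall v : 'cV[C]_n, 0 <= (v^t* *m A *m v) 0 0.

(* T bit queries on nu = m' + m'' + a qubits, the last a being ancillas.  The
   measurement is an arbitrary quantum measurement with outcomes 0, ..., M-1,
   given by its effects (a POVM); it includes projective measurements. *)
Record bit_query_algorithm (T : nat) := BitQueryAlgorithm {
  alg_m' : nat;
  alg_m'' : nat;
  alg_a : nat;
  alg_dim := (2 ^ alg_m' * 2 ^ alg_m'' * 2 ^ alg_a)%N;
  alg_tau : 'I_(2 ^ alg_m') -> R;
  alg_beta : R -> 'I_(2 ^ alg_m'');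
  alg_psi0 : 'cV[C]_alg_dim;
  alg_U : nat -> 'M[C]_alg_dim;
  alg_M : nat;
  alg_E : 'I_alg_M -> 'M[C]_alg_dim;
  alg_lambda : 'I_alg_M -> R;
  alg_tau01 : forall j, alg_tau j \in `[0, 1];
  alg_psi0_unit : (alg_psi0^t* *m alg_psi0) 0 0 = 1;
  alg_U_unitary : forall t, (t <= T)%N -> alg_U t \is unitarymx;
  alg_M_le : (alg_M <= 2 ^ (alg_m' + alg_m'' + alg_a))%N;
  alg_E_psd : forall j, psd (alg_E j);
  alg_E_sum : \sum_j alg_E j = 1%:M
}.

Section Run.
Variables (T : nat) (A : bit_query_algorithm T) (q : R -> R).

Definition alg_query : 'M[C]_(alg_dim A) :=
  bit_query (@alg_tau _ A) (@alg_beta _ A) q *t (1%:M : 'M[C]_(2 ^ alg_a A)).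

Fixpoint alg_state (t : nat) : 'cV[C]_(alg_dim A) :=
  if t is t'.+1 then alg_U A t *m (alg_query *m alg_state t')
  else alg_U A 0 *m alg_psi0 A.

Definition alg_prob (j : 'I_(alg_M A)) : R :=
  complex.Re (((alg_state T)^t* *m alg_E j *m alg_state T) 0 0).

End Run.

Definition computes_approximation T (A : bit_query_algorithm T) (eps : R) :=
  forall q, class_Q q ->
    3 / 4 <= \sum_(j | `|lambda q - alg_lambda j| <= eps) alg_prob (A := A) q j.

(* Equal to +oo if no algorithm computes an eps-approximation. *)
Definition n_bit_query (eps : R) : \bar R :=
  ereal_inf [set (T%:R)%:E | T in
    [set T | exists A : bit_query_algorithm T, computes_approximation A eps]].

End BitQueries.

(* Main.v *)
Require Import Defs.
From mathcomp Require Import all_boot all_order all_algebra.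
From mathcomp Require Import all_classical all_reals all_analysis.
From mathcomp Require Import spectral complex mxtens ring lra.

(* An adversary argument. Let [q x], for [x] in {0,1}^n, be the sum of those
   bumps of width and height ~ 1/n and ~ 1/n^2 whose bit in [x] is set, at n
   disjoint places. A query is sensitive to at most one bit, so that the sum over
   all the edges (x, x') of the hypercube of |psi_x - psi_x'|^2 grows by at most
   4 * 2^n per query. If an algorithm separates [lambda (q x)] from
   [lambda (q x')] on every edge then this sum is at least n * 2^n / 8 at the end,
   whence n <= 32 T.

   Flipping a single bit changes the eigenvalue by ~ n^-3: if [f] and [g] are the
   ground states for [q] and [q'], then f' g - f g' vanishes at both ends and has
   derivative (q - q' - lambda + lambda') f g, with [f] and [g] bounded above and
   below by multiples of the distance to the boundary. Hence n may be taken
   ~ eps^(-1/3).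

   The potentials are even about 1/2. A ground state is then obtained by solving
   the initial value problem on [0, 1/2] by Picard iteration for each spectral
   parameter in [8, 16], and choosing the parameter so that the derivative
   vanishes at 1/2 (intermediate value theorem applied to the logarithmic
   derivative); its even reflection is a positive eigenfunction, and a positive
   eigenfunction belongs to the least eigenvalue by Picone's identity. *)

Set Implicit Arguments.
Unset Strict Implicit.
Unset Printing Implicit Defensive.
Import Order.TTheory GRing.Theory Num.Theory.
Import numFieldNormedType.Exports.
Local Open Scope classical_set_scope.
Local Open Scope ring_scope.

(** * Adversary bound for bit queries *)

(** Kept in [complex R], like the quadratic forms of the effects, so that real parts enter only in
    [measurement_gap]. *)
Definition nrm2 (R : realType) d (v : 'cV[complex R]_d) : complex R :=
  \sum_r `|v r 0| ^+ 2.

Definition flip n (i : 'I_n) (x : {ffun 'I_n -> bool}) : {ffun 'I_n -> bool} :=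
  [ffun j => x j (+) (j == i)].

Lemma flipK n (i : 'I_n) : involutive (flip i).
Proof. by move=> x; apply/ffunP => j; rewrite !ffunE addbK. Qed.

(** Each [flip i] is an involution of the cube, so both summands have the same total. The left side
    has the form of the increment in [query_step]. *)
Lemma sum_flip (V : pzRingType) n (f : {ffun 'I_n -> bool} -> 'I_n -> V) :
  \sum_x \sum_i 2 * (f x i + f (flip i x) i) = 4 * \sum_x \sum_i f x i.
Proof.
have flipE : \sum_x \sum_i f (flip i x) i = \sum_x \sum_i f x i.
  rewrite exchange_big [RHS]exchange_big; apply: eq_bigr => i _.
  rewrite (reindex_inj (inv_inj (@flipK n i))); apply: eq_bigr => x _.
  by rewrite flipK.
under eq_bigr do rewrite -mulr_sumr big_split.
rewrite -mulr_sumr big_split /= flipE.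
by rewrite -mulr2n -[X in _ * X]mulr_natl mulrA -natrM.
Qed.

(** * Squared norms, quadratic forms and basis permutations *)

Section Norm2.
Variables (R : realType) (d : nat).
Local Notation C := (complex R).
Implicit Types (v w : 'cV[C]_d).
Local Open Scope sesquilinear_scope.

Lemma nrm2E v : (v^t* *m v) 0 0 = nrm2 v.
Proof.
rewrite mxE /nrm2; apply: eq_bigr => i _.
by rewrite !mxE normCK mulrC.
Qed.

Lemma nrm2_unitary (U : 'M[C]_d) v : U \is unitarymx -> nrm2 (U *m v) = nrm2 v.
Proof.
move=> /unitarymxP /mulmx1C UU.
by rewrite -!nrm2E trmx_mul map_mxM mulmxA -(mulmxA _ _ U) UU mulmx1.
Qed.

(** Parallelogram identity: the defect is the squared modulus of [a + b]. *)
Lemma sqr_normB_le (a b : C) : `|a - b| ^+ 2 <= 2 * (`|a| ^+ 2 + `|b| ^+ 2).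
Proof.
rewrite -subr_ge0; suff -> : 2 * (`|a| ^+ 2 + `|b| ^+ 2) - `|a - b| ^+ 2 =
  `|a + b| ^+ 2 by rewrite exprn_ge0.
by rewrite !normCK rmorphB rmorphD; ring.
Qed.

(** The defect is the quadratic form of [E] at [2 w - v]. This compares the probabilities of one
    event in two nearby states. *)
Lemma quad_le (E : 'M[C]_d) v w : psd E ->
  (v^t* *m E *m v) 0 0 <=
  2 * (w^t* *m E *m w) 0 0 + 2 * ((v - w)^t* *m E *m (v - w)) 0 0.
Proof.
move=> Epsd; pose b (x y : 'cV[C]_d) : C := (x^t* *m E *m y) 0 0.
have bDl x y z : b (x + y) z = b x z + b y z.
  by rewrite /b linearD /= map_mxD !mulmxDl mxE.
have bNl x z : b (- x) z = - b x z.
  by rewrite /b linearN /= map_mxN !mulNmx mxE.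
have bDr x y z : b z (x + y) = b z x + b z y by rewrite /b mulmxDr mxE.
have bNr x z : b z (- x) = - b z x by rewrite /b mulmxN mxE.
rewrite -subr_ge0 -!/(b _ _); have := Epsd (w *+ 2 - v); rewrite -/(b _ _).
rewrite !mulr2n !(bDl, bDr, bNl, bNr).
move: (b v v) (b v w) (b w v) (b w w) => vv vw wv ww H.
by apply: etrans H; congr (0 <= _); ring.
Qed.

(* Two unitaries permuting the basis that agree off [S] cannot separate the
   components of their arguments off [S]. *)
Lemma nrm2_perm_sub (S : pred 'I_d) (s1 s2 : 'I_d -> 'I_d) v1 v2 w1 w2 :
  injective s1 -> injective s2 ->
  (forall c, S (s1 c) = S c) -> (forall c, S (s2 c) = S c) ->
  (forall c, ~~ S c -> s1 c = s2 c) ->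
  (forall c, w1 (s1 c) 0 = v1 c 0) -> (forall c, w2 (s2 c) 0 = v2 c 0) ->
  nrm2 (w1 - w2) <= nrm2 (v1 - v2) +
    2 * \sum_(r | S r) (`|v1 r 0| ^+ 2 + `|v2 r 0| ^+ 2).
Proof.
move=> i1 i2 S1 S2 s12 e1 e2.
(* Off [S] one permutation serves both vectors; on [S] only the parallelogram bound is used. *)
rewrite /nrm2 (bigID S) /= addrC lerD//.
  rewrite (reindex_inj i1) /=.
  under eq_bigl do rewrite S1.
  rewrite [leRHS](bigID S) /= ler_wpDl//.
    by apply: sumr_ge0 => i _; rewrite exprn_ge0.
  apply: ler_sum => c Sc.
  by rewrite !mxE e1 s12// e2.
apply: (@le_trans _ _ (\sum_(r | S r) 2 * (`|w1 r 0| ^+ 2 + `|w2 r 0| ^+ 2))).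
  by apply: ler_sum => r _; rewrite !mxE sqr_normB_le.
rewrite -mulr_sumr ler_wpM2l// !big_split /= lerD//.
  rewrite (reindex_inj i1) /=.
  under eq_bigl do rewrite S1.
  by apply: ler_sum => c _; rewrite e1.
rewrite (reindex_inj i2) /=.
under eq_bigl do rewrite S2.
by apply: ler_sum => c _; rewrite e2.
Qed.

End Norm2.

(** * The bit query as a permutation of the basis *)

Section Query.
Variables (R : realType) (T : nat) (A : bit_query_algorithm R T).
Local Open Scope sesquilinear_scope.
Local Notation C := (complex R).
Implicit Types (q : R -> R) (v : 'cV[C]_(alg_dim A)).

Definition query_pos (c : 'I_(alg_dim A)) : 'I_(2 ^ alg_m' A) :=
  (mxtens_unindex (mxtens_unindex c).1).1.

Lemma addmod_ltn (m k l : nat) : ((k + l) %% 2 ^ m < 2 ^ m)%N.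
Proof. by rewrite ltn_mod expn_gt0. Qed.

(** The permutation of basis indices whose matrix is [alg_query A q] (see [alg_queryE]); only the
    answer register moves. *)
Definition query_perm q (c : 'I_(alg_dim A)) : 'I_(alg_dim A) :=
  let b := @alg_beta _ _ A (q (@alg_tau _ _ A (query_pos c))) in
  let k := (mxtens_unindex (mxtens_unindex c).1).2 in
  mxtens_index (mxtens_index (query_pos c,
    Ordinal (addmod_ltn (alg_m'' A) k b)), (mxtens_unindex c).2).

Lemma query_perm_pos q c : query_pos (query_perm q c) = query_pos c.
Proof. by rewrite /query_pos /query_perm !mxtens_indexK. Qed.

Lemma query_perm_inj q : injective (query_perm q).
Proof.
move=> c d cd; have := cd; rewrite /query_perm.
move=> /(can_inj (@mxtens_indexK _ _)) e.
have ea := congr1 snd e.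
have {}e := can_inj (@mxtens_indexK _ _) (congr1 fst e).
have pj : query_pos c = query_pos d := congr1 fst e.
have ek := congr1 (val \o snd) e.
rewrite -[c]mxtens_unindexK -[d]mxtens_unindexK; congr mxtens_index.
rewrite [LHS]surjective_pairing [RHS]surjective_pairing.
congr (_, _); last exact: ea.
rewrite -[LHS]mxtens_unindexK -[RHS]mxtens_unindexK; congr mxtens_index.
rewrite [LHS]surjective_pairing [RHS]surjective_pairing.
congr (_, _); first exact: pj.
apply: val_inj.
move/eqP: ek; rewrite /= pj eqn_modDr.
by rewrite !modn_mod => /eqP.
Qed.

Lemma alg_queryE q (c c' : 'I_(alg_dim A)) :
  alg_query A q c c' = (c == query_perm q c')%:R.
Proof.
rewrite /alg_query /tensmx /bit_query !mxE.
set u := (mxtens_unindex c).1; set u' := (mxtens_unindex c').1.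
rewrite (surjective_pairing (mxtens_unindex u)).
rewrite (surjective_pairing (mxtens_unindex u')) -natrM mulnb.
congr (nat_of_bool _)%:R; apply/idP/eqP.
  move=> /andP[/andP[/eqP ej /eqP ek] /eqP ea].
  rewrite /query_perm -[LHS]mxtens_unindexK; congr mxtens_index.
  rewrite [LHS]surjective_pairing; congr (_, _) => //.
  rewrite -[LHS]mxtens_unindexK; congr mxtens_index.
  rewrite [LHS]surjective_pairing; congr (_, _) => //.
  exact: val_inj.
move=> e; have := congr1 (@mxtens_unindex _ _) e.
rewrite /query_perm mxtens_indexK (surjective_pairing (mxtens_unindex c)).
move=> {}e; have ec2 := congr1 snd e.
have := congr1 (@mxtens_unindex _ _) (congr1 fst e).
rewrite mxtens_indexK -/u => {}e.
rewrite -!andbA; apply/and3P; split; apply/eqP; last exact: ec2.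
  exact: (congr1 fst e).
exact: (congr1 (val \o snd) e).
Qed.

Lemma alg_query_perm q v c : (alg_query A q *m v) (query_perm q c) 0 = v c 0.
Proof.
rewrite mxE (bigD1 c)//= alg_queryE eqxx mul1r big1 ?addr0// => c' c'c.
rewrite alg_queryE (inj_eq (@query_perm_inj q)) eq_sym.
by rewrite (negbTE c'c) mul0r.
Qed.

Lemma nrm2_query q v : nrm2 (alg_query A q *m v) = nrm2 v.
Proof.
rewrite /nrm2 (reindex_inj (@query_perm_inj q)) /=.
by apply: eq_bigr => c _; rewrite alg_query_perm.
Qed.

Lemma nrm2_state q t : (t <= T)%N -> nrm2 (alg_state A q t) = 1.
Proof.
elim: t => [|t IH] tT /=.
  by rewrite nrm2_unitary ?alg_U_unitary// -nrm2E alg_psi0_unit.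
by rewrite nrm2_unitary ?alg_U_unitary// nrm2_query IH// ltnW.
Qed.

(** The unitary after the query preserves the distance, and the two query permutations differ only
    on basis states whose queried place lies in [S]. *)
Lemma query_step q1 q2 (S : pred R) t : (t < T)%N ->
  (forall s, s \in `[0, 1] -> ~~ S s -> q1 s = q2 s) ->
  nrm2 (alg_state A q1 t.+1 - alg_state A q2 t.+1) <=
  nrm2 (alg_state A q1 t - alg_state A q2 t) +
  2 * \sum_(r | S (@alg_tau _ _ A (query_pos r)))
     (`|alg_state A q1 t r 0| ^+ 2 + `|alg_state A q2 t r 0| ^+ 2).
Proof.
move=> tT q12 /=; rewrite -mulmxBr nrm2_unitary ?alg_U_unitary//.
apply: (@nrm2_perm_sub _ _ _ (query_perm q1) (query_perm q2)).
- exact: query_perm_inj.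
- exact: query_perm_inj.
- by move=> c /=; rewrite query_perm_pos.
- by move=> c /=; rewrite query_perm_pos.
- move=> c Sc; rewrite /query_perm; congr mxtens_index; congr (_, _).
  congr mxtens_index; congr (_, _); apply: val_inj => /=.
  by rewrite q12// alg_tau01.
- by move=> c; rewrite alg_query_perm.
- by move=> c; rewrite alg_query_perm.
Qed.

(** The outcomes that are correct for [q1] and for [q2] are disjoint events. Those correct for [q1]
    thus have probability at least 3/4 in one final state and at most 1/4 in the other, and
    [quad_le] gives 3/4 <= 2/4 + 2 |v - w|^2. *)
Lemma measurement_gap q1 q2 eps : class_Q q1 -> class_Q q2 ->
  computes_approximation A eps -> 2 * eps < `|lambda q1 - lambda q2| ->
  1 <= 8%:R * nrm2 (alg_state A q1 T - alg_state A q2 T).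
Proof.
move=> Q1 Q2 Aeps gap.
set v := alg_state A q1 T; set w := alg_state A q2 T.
pose e j (z : 'cV[C]_(alg_dim A)) := (z^t* *m alg_E j *m z) 0 0.
have e_ge0 j z : 0 <= e j z by exact: alg_E_psd.
have sum_e z : \sum_j e j z = nrm2 z.
  rewrite -nrm2E -[X in _ *m X]mul1mx -(alg_E_sum A) mulmx_suml mulmx_sumr.
  by rewrite summxE; apply: eq_bigr => j _; rewrite /e mulmxA.
have ReC (z : C) : 0 <= z -> z = (complex.Re z)%:C%C.
  by move=> /ger0_Im; case: z => a b /= ->.
pose G1 j := `|lambda q1 - alg_lambda (b:=A) j| <= eps.
pose G2 j := `|lambda q2 - alg_lambda (b:=A) j| <= eps.
have G12 j : G1 j -> ~~ G2 j.
  rewrite /G1 /G2 -ltNge => H1.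
  have := ler_distD (alg_lambda (b:=A) j) (lambda q1) (lambda q2).
  rewrite (distrC (alg_lambda j)); lra.
have probC q (G : pred 'I_(alg_M A)) : 3 / 4 <= \sum_(j | G j) alg_prob q j ->
    3 / 4 <= \sum_(j | G j) e j (alg_state A q T).
  move=> H; have -> : \sum_(j | G j) e j (alg_state A q T) =
      (\sum_(j | G j) alg_prob q j)%:C%C.
    by rewrite rmorph_sum; apply: eq_bigr => j _; exact: ReC.
  have -> : (3 / 4 : C) = (3 / 4)%:C%C by rewrite fmorph_div !rmorph_nat.
  by rewrite lecR.
have P1 := probC _ _ (Aeps _ Q1); have P2 := probC _ _ (Aeps _ Q2).
have w1 : \sum_j e j w = 1 by rewrite sum_e nrm2_state.
have Gw : \sum_(j | G1 j) e j w <= 1 / 4.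
  rewrite (_ : 1 / 4 = 1 - 3 / 4); last by field.
  rewrite lerBrDl -[leRHS]w1.
  apply: (le_trans (lerD P2 (lexx _))).
  rewrite [leRHS](bigID G2)/= lerD2l.
  rewrite big_mkcond [leRHS]big_mkcond; apply: ler_sum => j _.
  by case: ifP => [/G12 ->//|_]; case: ifP.
have H : \sum_(j | G1 j) e j v <=
    2 * \sum_(j | G1 j) e j w + 2 * nrm2 (v - w).
  rewrite -sum_e !mulr_sumr; apply: (@le_trans _ _
    (\sum_(j | G1 j) 2 * e j w + \sum_(j | G1 j) 2 * e j (v - w))).
    by rewrite -big_split; apply: ler_sum => j _; apply: quad_le; exact: alg_E_psd.
  rewrite lerD2l [leRHS](bigID G1)/= ler_wpDr//.
  by apply: sumr_ge0 => j _; rewrite mulr_ge0.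
have {P1}H : 3 / 4 <= 2 * (1 / 4) + 2 * nrm2 (v - w).
  by apply: (le_trans P1); apply: (le_trans H); rewrite lerD2r ler_wpM2l.
rewrite -subr_ge0 in H.
rewrite -subr_ge0 (_ : _ - 1 = 4%:R * (2 * (1 / 4) + 2 * nrm2 (v - w) - 3 / 4)).
  by rewrite mulr_ge0.
by field.
Qed.

End Query.

(** * The progress measure over the hypercube *)

Section Adversary.
Variables (R : realType) (n T : nat) (A : bit_query_algorithm R T) (eps : R).
Variables (q : {ffun 'I_n -> bool} -> R -> R) (S : 'I_n -> pred R).
Local Notation C := (complex R).
Hypothesis q_class : forall x, class_Q (q x).
Hypothesis q_local : forall x i s,
  s \in `[0, 1] -> ~~ S i s -> q x s = q (flip i x) s.
Hypothesis S_disj : forall i j s, S i s -> S j s -> i = j.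
Hypothesis A_eps : computes_approximation A eps.
Hypothesis gap : forall x i, 2 * eps < `|lambda (q x) - lambda (q (flip i x))|.

Let st x t := alg_state A (q x) t.
(** Every edge of the cube is counted from both ends, so there are [n * 2 ^ n] terms. *)
Let progress t := \sum_x \sum_i nrm2 (st x t - st (flip i x) t).

Lemma progress_step t : (t < T)%N ->
  progress t.+1 <= progress t + (4 * 2 ^ n)%:R.
Proof.
move=> tT; pose D i r := S i (@alg_tau _ _ A (query_pos r)).
apply: (@le_trans _ _ (progress t + \sum_x \sum_i 2 * \sum_(r | D i r)
   (`|st x t r 0| ^+ 2 + `|st (flip i x) t r 0| ^+ 2))).
  rewrite /progress -big_split /=; apply: ler_sum => x _.
  rewrite -big_split /=; apply: ler_sum => i _.
  by apply: query_step => // s; exact: q_local.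
rewrite lerD2l.
(* The sets [D i] are disjoint, so for each [x] the inner double sum is at most the squared norm 1
   of the state. *)
have mass : \sum_x \sum_i \sum_(r | D i r) `|st x t r 0| ^+ 2 <= (2 ^ n)%:R :> C.
  apply: (@le_trans _ _ (\sum_(x : {ffun 'I_n -> bool}) (1 : C))); last first.
    by rewrite sumr_const card_ffun card_bool card_ord.
  apply: ler_sum => x _; rewrite -(@nrm2_state _ _ A (q x) _ (ltnW tT)).
  rewrite (exchange_big_dep predT)//=; apply: ler_sum => r _.
  rewrite sumr_const -[leRHS]mulr1n ler_wpMn2l ?exprn_ge0//.
  rewrite leqNgt; apply/negP => /card_gt1P[i [j [Di Dj /eqP]]].
  by apply; exact: S_disj Di Dj.
under eq_bigr do under eq_bigr do rewrite big_split.
rewrite (sum_flip (fun x i => \sum_(r | D i r) `|st x t r 0| ^+ 2)).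
by rewrite natrM ler_pM// ?ler_nat// sumr_ge0// => x _; rewrite sumr_ge0// => i _;
  rewrite sumr_ge0// => r _; rewrite exprn_ge0.
Qed.

Lemma progress_le t : (t <= T)%N -> progress t <= (4 * 2 ^ n * t)%:R.
Proof.
elim: t => [_|t IH tT].
  rewrite muln0 /progress big1// => x _; rewrite big1// => i _.
  by rewrite /st /= subrr /nrm2 big1// => r _; rewrite mxE normr0 expr0n.
by rewrite mulnS natrD addrC (le_trans (progress_step tT))// lerD2r IH// ltnW.
Qed.

(** Each of the [n * 2 ^ n] terms is at least 1/8 at the end, while the total is at most
    [4 * 2 ^ n * T]. *)
Theorem adversary_bound : (n <= 32 * T)%N.
Proof.
have H : (n * 2 ^ n)%:R <= 8%:R * progress T :> C.
  rewrite /progress mulr_sumr.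
  apply: (@le_trans _ _ (\sum_(x : {ffun 'I_n -> bool}) n%:R)).
    by rewrite sumr_const card_ffun card_bool card_ord natrM mulr_natr.
  apply: ler_sum => x _; rewrite mulr_sumr.
  apply: (@le_trans _ _ (\sum_(i < n) 1)); first by rewrite sumr_const card_ord.
  by apply: ler_sum => i _; apply: (@measurement_gap _ _ _ _ _ eps).
have {}H : (n * 2 ^ n)%:R <= 8%:R * (4 * 2 ^ n * T)%:R :> C.
  by apply: (le_trans H); rewrite ler_wpM2l// progress_le.
move: H; rewrite -natrM ler_nat !mulnA -mulnA (mulnC _ T) mulnA leq_mul2r.
by rewrite expn_eq0 /= mulnC.
Qed.

End Adversary.

(** * Calculus on the real line *)

Section Calculus.
Variable R : realType.
Implicit Types (f g : R -> R) (a b x d e : R).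

(** A form without quotients, which also admits [y = x]. With the same form for [deriv01], two-sided
    and one-sided derivatives are compared directly. *)
Lemma is_deriveP f x d : is_derive x 1 f d <-> forall e, 0 < e ->
  exists2 r, 0 < r & forall y, `|y - x| < r ->
    `|f y - f x - d * (y - x)| <= e * `|y - x|.
Proof.
have cvgE : (h^-1 *: (f (h *: 1 + x) - f x) @[h --> 0^'] --> d) <->
  forall e, 0 < e -> exists2 r, 0 < r & forall y, `|y - x| < r ->
    `|f y - f x - d * (y - x)| <= e * `|y - x|.
  split=> [/cvgrPdist_le H e e0|H].
    have [r /= r0 Hr] := H e e0; exists r => // y yx.
    have [->|yNx] := eqVneq y x; first by rewrite !subrr mulr0 subrr normr0 mulr0.
    have := Hr (y - x); rewrite /ball /= sub0r normrN subr_eq0 => /(_ yx yNx).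
    rewrite [_ *: 1]mulr1 subrK [_ *: _]mulrC distrC => {}Hr.
    have yx0 : y - x != 0 by rewrite subr_eq0.
    by rewrite -[X in X - d * _](divfK yx0) -mulrBl normrM ler_wpM2r.
  apply/cvgrPdist_le => e e0; have [r r0 Hr] := H e e0.
  exists r => //= h /=; rewrite sub0r normrN => hr h0.
  have := Hr (h + x); rewrite addrK => /(_ hr).
  rewrite [_ *: 1]mulr1 [_ *: _]mulrC => {}Hr.
  rewrite distrC -[X in _ - X](mulfK h0) -mulrBl normrM normfV.
  by rewrite ler_pdivrMr ?normr_gt0.
rewrite -cvgE; split=> [[df <-]|H]; first exact: df.
by split; [exact: cvgP H|exact: cvg_lim H].
Qed.

Lemma deriv01P f x d : deriv01 f x d <-> forall e, 0 < e ->
  exists2 r, 0 < r & forall y, y \in `[0, 1] -> `|y - x| < r ->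
    `|f y - f x - d * (y - x)| <= e * `|y - x|.
Proof.
rewrite /deriv01; split=> [/cvgrPdist_le H e e0|H].
  have [r /= r0 Hr] := H e e0; exists r => // y y01 yx.
  have [->|yNx] := eqVneq y x; first by rewrite !subrr mulr0 subrr normr0 mulr0.
  have := Hr y; rewrite /ball /= distrC => /(_ yx yNx y01); rewrite distrC => {}Hr.
  have yx0 : y - x != 0 by rewrite subr_eq0.
  by rewrite -[X in X - d * _](divfK yx0) -mulrBl normrM ler_wpM2r.
apply/cvgrPdist_le => e e0; have [r r0 Hr] := H e e0.
exists r => //= y /=; rewrite distrC => yr yx y01.
have yx0 : y - x != 0 by rewrite subr_eq0.
rewrite distrC -[X in _ - X](mulfK yx0) -mulrBl normrM normfV.
by rewrite ler_pdivrMr ?normr_gt0// Hr.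
Qed.

Lemma is_derive_deriv01 f x d : is_derive x 1 f d -> deriv01 f x d.
Proof.
move=> /is_deriveP H; apply/deriv01P => e e0; have [r r0 Hr] := H e e0.
by exists r => // y _; exact: Hr.
Qed.

Lemma deriv01_is_derive f x d : x \in `]0, 1[ -> deriv01 f x d ->
  is_derive x 1 f d.
Proof.
rewrite in_itv /= => /andP[x0 x1] /deriv01P H; apply/is_deriveP => e e0.
have [r r0 Hr] := H e e0.
exists (Num.min r (Num.min x (1 - x))); first by rewrite !lt_min r0 x0 subr_gt0.
move=> y; rewrite !lt_min => /and3P[yr yx y1]; apply: Hr => //.
by rewrite in_itv /=; move: yx y1; rewrite !ltr_norml => /andP[? ?] /andP[? ?];
  apply/andP; split; lra.
Qed.

Lemma continuousP_dist f x : {for x, continuous f} <-> forall e, 0 < e ->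
  exists2 r, 0 < r & forall y, `|y - x| < r -> `|f y - f x| <= e.
Proof.
split=> [/cvgrPdist_le H e e0|H].
  have [r /= r0 Hr] := H e e0; exists r => // y yx.
  by have := Hr y; rewrite /ball /= distrC => /(_ yx); rewrite distrC.
apply/cvgrPdist_le => e e0; have [r r0 Hr] := H e e0.
by exists r => //= y /=; rewrite distrC => /Hr; rewrite distrC.
Qed.

Lemma is_derive_continuous f x d : is_derive x 1 f d -> {for x, continuous f}.
Proof. by move=> [/derivable1_diffP/differentiable_continuous]. Qed.

Lemma is_derive_glue f g a d : f a = g a -> is_derive a 1 f d ->
  is_derive a 1 g d -> is_derive a 1 (fun x => if x <= a then f x else g x) d.
Proof.
move=> fga /is_deriveP df /is_deriveP dg; apply/is_deriveP => e e0.
have [r r0 Hr] := df e e0; have [s s0 Hs] := dg e e0.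
exists (Num.min r s); first by rewrite lt_min r0.
move=> y; rewrite lt_min lexx => /andP[/Hr ? /Hs ?]; case: ifP => // _.
by rewrite fga.
Qed.

Lemma is_derive_local f g a r d : 0 < r ->
  (forall x, `|x - a| < r -> f x = g x) -> is_derive a 1 f d ->
  is_derive a 1 g d.
Proof.
move=> r0 fg /is_deriveP df; apply/is_deriveP => e e0.
have [s s0 Hs] := df e e0; exists (Num.min r s); first by rewrite lt_min r0.
move=> y; rewrite lt_min => /andP[yr ys].
by rewrite -!fg ?subrr ?normr0//; exact: Hs.
Qed.

Lemma derive_addf f g x a b : is_derive x 1 f a -> is_derive x 1 g b ->
  is_derive x 1 (fun y => f y + g y) (a + b).
Proof. exact: is_deriveD. Qed.

Lemma derive_subf f g x a b : is_derive x 1 f a -> is_derive x 1 g b ->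
  is_derive x 1 (fun y => f y - g y) (a - b).
Proof. exact: is_deriveB. Qed.

Lemma derive_mulf f g x a b : is_derive x 1 f a -> is_derive x 1 g b ->
  is_derive x 1 (fun y => f y * g y) (a * g x + f x * b).
Proof.
move=> df dg; apply: (@is_derive_eq _ _ _ (f * g)) => //.
by rewrite addrC [_ *: _]mulrC [_ *: _]mulrC [b * _]mulrC.
Qed.

Lemma derive_constf k x : is_derive x 1 (fun=> k : R) 0.
Proof. exact: is_derive_cst. Qed.

Lemma derive_scalef f k x a : is_derive x 1 f a -> is_derive x 1 (fun y => k * f y) (k * a).
Proof. by move=> df; apply: is_derive_eq (derive_mulf (derive_constf k x) df) _; rewrite mul0r add0r. Qed.

Lemma derive_powf n x : is_derive x 1 (fun y : R => y ^+ n.+1) (n.+1%:R * x ^+ n).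
Proof.
split; first exact: exprn_derivable.
by rewrite exp_derive scaler1.
Qed.

Lemma derive_monomf k n x :
  is_derive x 1 (fun y : R => k * y ^+ n.+1) (k * (n.+1%:R * x ^+ n)).
Proof. exact: (derive_scalef k (derive_powf n x)). Qed.

Lemma deriv_reflect f x d : is_derive (1 - x) 1 f d ->
  is_derive x 1 (fun y => f (1 - y)) (- d).
Proof.
move=> df; have dg : is_derive x 1 (fun y : R => 1 - y) (- 1).
  by have := derive_subf (derive_constf 1 x) (is_derive_id x 1); rewrite sub0r.
by have := @is_derive1_comp _ f (fun y => 1 - y) x d (- 1) df dg; rewrite mulrN1.
Qed.

Lemma deriv_ndecr f (df : R -> R) a b : a <= b ->
  (forall x, x \in `[a, b] -> is_derive x 1 f (df x)) ->
  (forall x, x \in `[a, b] -> 0 <= df x) -> f a <= f b.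
Proof.
move=> ab dfE df0.
have cf : {within `[a, b], continuous f}.
  by apply: derivable_within_continuous => x xab; have [] := dfE x xab.
have dfo x : x \in `]a, b[ -> is_derive x 1 f (df x).
  by move=> xab; apply: dfE; exact: subset_itv_oo_cc xab.
have [c cab E] := MVT_segment ab dfo cf.
by rewrite -subr_ge0 E mulr_ge0 ?df0// subr_ge0.
Qed.

(** A 1-Lipschitz retraction onto the segment; it extends to the whole line what is known only on
    [[a, b]]. *)
Definition clamp a b x := Num.max a (Num.min x b).

Lemma clamp_in a b x : a <= b -> clamp a b x \in `[a, b].
Proof. by move=> ab; rewrite in_itv /= /clamp le_max lexx ge_max ge_min lexx ab orbT. Qed.

Lemma clamp_id a b x : x \in `[a, b] -> clamp a b x = x.
Proof.
rewrite in_itv /= => /andP[x0 x1].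
by rewrite /clamp (min_idPl x1) (max_idPr x0).
Qed.

Lemma clamp_dist a b x y : `|clamp a b x - clamp a b y| <= `|x - y|.
Proof.
have h1 := ler_norm (x - y); have h2 := ler_norm (y - x).
rewrite distrC in h2; rewrite ler_norml /clamp.
have [xb|xb] := leP x b; have [yb|yb] := leP y b.
- by have [ax|ax] := leP a x; have [ay|ay] := leP a y; apply/andP; split; lra.
- by have [ax|ax] := leP a x; have [ay|ay] := leP a b; apply/andP; split; lra.
- by have [ax|ax] := leP a b; have [ay|ay] := leP a y; apply/andP; split; lra.
- by have [ax|ax] := leP a b; apply/andP; split; lra.
Qed.

Lemma lipschitz_continuous f k x : 0 < k ->
  (forall y, `|f y - f x| <= k * `|y - x|) -> {for x, continuous f}.
Proof.
move=> k0 H; apply/continuousP_dist => e e0; exists (e / k).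
  by rewrite divr_gt0.
move=> y yx; apply: (le_trans (H y)).
by rewrite mulrC -ler_pdivlMr// ltW.
Qed.

Lemma clamp_continuous a b : continuous (clamp a b).
Proof.
move=> x; apply: (@lipschitz_continuous _ 1) => // y.
by rewrite mul1r clamp_dist.
Qed.

End Calculus.

(** * Primitives of continuous functions *)

Section Primitive.
Variable R : realType.
Notation mu := (@lebesgue_measure R).
Implicit Types (f g : R -> R) (x : R).

(** The signed integral from 0, so that it is differentiable also at 0 and to the left of it. *)
Definition prim (f : R -> R) (x : R) : R :=
  \int[mu]_(t in `]0, x]) f t - \int[mu]_(t in `]x, 0]) f t.

Lemma prim0 f : prim f 0 = 0.
Proof. by rewrite /prim subrr. Qed.

Lemma prim_deriv f x : continuous f -> is_derive x 1 (prim f) (f x).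
Proof.
move=> cf; pose M := `|x| + 1.
have M0 : 0 < M by rewrite /M ltr_wpDl.
have xM : - M < x < M by rewrite -ltr_norml /M ltrDl.
have intf a b : mu.-integrable `[a, b] (EFin \o f).
  apply: continuous_compact_integrable; first exact: segment_compact.
  exact: continuous_subspaceT.
(* The fundamental theorem is applied from a base point [- M] to the left of both 0 and [x]; near
   [x], [prim f] is [G - G 0]. *)
pose G y := \int[mu]_(t in `[- M, y]) f t.
have dG : is_derive x 1 G (f x).
  have /andP[Mx xM'] := xM.
  have [] := @continuous_FTC1_closed R f (- M) x M xM' (intf _ _) Mx (cf x).
  by move=> dG <-; rewrite derive1E; split.
apply: (@is_derive_local _ (fun y => G y - G 0) _ _ 1) => //; last first.
  by apply: is_derive_eq (derive_subf dG (derive_constf (G 0) x)) (subr0 _).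
move=> y; rewrite ltr_distl => /andP[y1 y2].
have yM : - M <= y.
  by move: y1; have := ler_norm (- x); rewrite normrN /M; lra.
have [y0|y0] := leP 0 y.
  rewrite /prim [X in _ = _ - X](_ : _ = 0) ?subr0; last first.
    by rewrite set_itv_ge ?Rintegral_set0// bnd_simp -leNgt.
  rewrite /G Rintegral_itvB// bnd_simp//; lra.
rewrite /prim [X in _ = X - _](_ : _ = 0) ?sub0r; last first.
  by rewrite set_itv_ge ?Rintegral_set0// bnd_simp -leNgt ltW.
rewrite /G -opprB Rintegral_itvB// bnd_simp; lra.
Qed.

Lemma prim_continuous f : continuous f -> continuous (prim f).
Proof. by move=> cf x; exact: is_derive_continuous (prim_deriv x cf). Qed.

(** Integrates a pointwise bound [h] given with its antiderivative [H]: both [H + (prim f - prim g)]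
    and [H - (prim f - prim g)] are nondecreasing. *)
Lemma prim_dist f g (H h : R -> R) x : continuous f -> continuous g -> 0 <= x ->
  (forall t, t \in `[0, x] -> is_derive t 1 H (h t)) -> H 0 = 0 ->
  (forall t, t \in `[0, x] -> `|f t - g t| <= h t) ->
  `|prim f x - prim g x| <= H x.
Proof.
move=> cf cg x0 dH H0 fgh; rewrite ler_norml; apply/andP; split.
  suff : H 0 + (prim f 0 - prim g 0) <= H x + (prim f x - prim g x).
    by rewrite H0 !prim0; lra.
  apply: (@deriv_ndecr _ (fun t => H t + (prim f t - prim g t))
    (fun t => h t + (f t - g t))) => // t tx.
    by apply: derive_addf; [exact: dH|apply: derive_subf; exact: prim_deriv].
  by have := fgh _ tx; rewrite ler_norml => /andP[]; lra.
suff : H 0 - (prim f 0 - prim g 0) <= H x - (prim f x - prim g x).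
  by rewrite H0 !prim0; lra.
apply: (@deriv_ndecr _ (fun t => H t - (prim f t - prim g t))
  (fun t => h t - (f t - g t))) => // t tx.
  by apply: derive_subf; [exact: dH|apply: derive_subf; exact: prim_deriv].
by have := fgh _ tx; rewrite ler_norml => /andP[]; lra.
Qed.

Lemma prim_le f (H h : R -> R) x : continuous f -> 0 <= x ->
  (forall t, t \in `[0, x] -> is_derive t 1 H (h t)) -> H 0 = 0 ->
  (forall t, t \in `[0, x] -> 0 <= f t <= h t) -> 0 <= prim f x <= H x.
Proof.
move=> cf x0 dH H0 fh; apply/andP; split.
  rewrite -(prim0 f); apply: (@deriv_ndecr _ (prim f) f) => // t tx.
    exact: prim_deriv.
  by have /andP[] := fh _ tx.
suff : H 0 - prim f 0 <= H x - prim f x by rewrite H0 prim0; lra.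
apply: (@deriv_ndecr _ (fun t => H t - prim f t) (fun t => h t - f t)) => // t tx.
  by apply: derive_subf; [exact: dH|exact: prim_deriv].
by have /andP[] := fh _ tx; lra.
Qed.

End Primitive.

(** * The initial value problem *)

Section GeometricCauchy.
Variable R : realType.

Lemma le0_geometric (x C r : R) : 0 <= r < 1 -> (forall n, x <= C * r ^+ n) ->
  x <= 0.
Proof.
move=> /andP[r0 r1] H; have rn : `|r| < 1 by rewrite ger0_norm.
have /cvgrPdist_le cv := @cvg_geometric R C r rn.
apply/ler_addgt0Pr => e e0; rewrite add0r.
have [N _ HN] := cv _ e0; have := HN N (leqnn N).
rewrite /geometric /= sub0r normrN => HNe.
by apply: (le_trans (H N)); apply: le_trans HNe; exact: ler_norm.
Qed.

(** The limit is the supremum of the lower bounds [u n - C * r ^+ n], each of which is at most every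
    [u m + C * r ^+ m]. *)
Lemma geometric_limit (u : nat -> R) (C r : R) :
  (forall n k, `|u (n + k)%N - u n| <= C * r ^+ n) ->
  exists l, forall n, `|l - u n| <= C * r ^+ n.
Proof.
move=> H; pose A := range (fun n => u n - C * r ^+ n).
have Aub m : ubound A (u m + C * r ^+ m).
  move=> _ [n _ <-]; have [nm|/ltnW mn] := leqP n m.
    have := H n (m - n)%N; rewrite subnKC// ler_norml => /andP[h _].
    have := H m 0%N; rewrite addn0 subrr normr0 => h2; lra.
  have := H m (n - m)%N; rewrite subnKC// ler_norml => /andP[_ h].
  have := H n 0%N; rewrite addn0 subrr normr0 => h2; lra.
have A0 : A !=set0 by exists (u 0%N - C * r ^+ 0), 0%N.
exists (sup A) => n; rewrite ler_norml; apply/andP; split.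
  have : u n - C * r ^+ n <= sup A.
    by apply: ub_le_sup; [exists (u 0%N + C * r ^+ 0)|exists n].
  by lra.
by have := ge_sup A0 (Aub n); lra.
Qed.

End GeometricCauchy.

Section Shooting.
Variable R : realType.
Implicit Types (p q f g : R -> R) (x t lam mu : R).

Local Notation half := (2^-1 : R).

Section Picard.
Variable p : R -> R.
Hypothesis p_cont : continuous p.
Hypothesis p_bound : forall t, t \in `[0, half] -> 0 <= p t <= 16.

(** The problem f'' = - p f, f(0) = 0, f'(0) = 1, integrated twice, reads
    [f t = t - volterra f t]. *)
Definition volterra f : R -> R := prim (prim (fun t => p t * f t)).

Fixpoint picard n : R -> R :=
  if n is n'.+1 then fun t => t - volterra (picard n') t else id.

Lemma pM_continuous f : continuous f -> continuous (fun t => p t * f t).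
Proof. by move=> cf x; apply: continuousM; [exact: p_cont|exact: cf]. Qed.

Lemma volterra_continuous f : continuous f -> continuous (volterra f).
Proof. by move=> cf; apply/prim_continuous/prim_continuous/pM_continuous. Qed.

Lemma picard_continuous n : continuous (picard n).
Proof.
elim: n => [|n IH] x /=; first exact: cvg_id.
by apply: continuousB; [exact: cvg_id|exact: volterra_continuous].
Qed.

(** Contraction for the supremum of |f(t)| / t. Integrating [16 * c * s] twice gives
    [8 / 3 * c * t ^+ 3], and t^2 <= 1/4 turns 8/3 into 2/3. *)
Lemma volterra_dist c f g t : continuous f -> continuous g ->
  (forall s, s \in `[0, half] -> `|f s - g s| <= c * s) ->
  t \in `[0, half] -> `|volterra f t - volterra g t| <= c * (2 / 3) * t.
Proof.
move=> cf cg fg t01; have := t01; rewrite in_itv /= => /andP[t0 t1].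
have c0 : 0 <= c.
  have := fg half; rewrite in_itv /= lexx invr_ge0 ler0n => /(_ isT).
  by have := normr_ge0 (f half - g half); lra.
have inh s x : x <= half -> s \in `[0, x] -> s \in `[0, half].
  by move=> xh; rewrite !in_itv /= => /andP[-> /le_trans]; apply.
apply: (@le_trans _ _ (c * (8 / 3) * t ^+ 3)); last first.
  by rewrite -!mulrA ler_wpM2l//; nra.
apply: (prim_dist (H := fun s => c * (8 / 3) * s ^+ 3) (h := fun s => c * 8 * s ^+ 2)
  (prim_continuous (pM_continuous cf)) (prim_continuous (pM_continuous cg)) t0).
- move=> s _; apply: is_derive_eq (derive_monomf _ 2 s) _; lra.
- by rewrite expr0n mulr0.
move=> s /(inh _ _ t1) sh; have := sh; rewrite in_itv /= => /andP[s0 s1].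
apply: (prim_dist (H := fun s => c * 8 * s ^+ 2) (h := fun s => c * 16 * s)
  (pM_continuous cf) (pM_continuous cg) s0).
- move=> r _; apply: is_derive_eq (derive_monomf _ 1 r) _; lra.
- by rewrite expr0n mulr0.
move=> r /(inh _ _ s1) rh; have /andP[p0 p16] := p_bound rh.
rewrite -mulrBr normrM ger0_norm// -mulrA mulrCA ler_pM// fg//.
Qed.

Lemma volterra_le f t : continuous f ->
  (forall s, s \in `[0, half] -> 0 <= f s <= s) ->
  t \in `[0, half] -> 0 <= volterra f t <= 8 / 3 * t ^+ 3.
Proof.
move=> cf fs; rewrite in_itv /= => /andP[t0 t1].
have inh s x : x <= half -> s \in `[0, x] -> s \in `[0, half].
  by move=> xh; rewrite !in_itv /= => /andP[-> /le_trans]; apply.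
apply: (prim_le (H := fun s => 8 / 3 * s ^+ 3) (h := fun s => 8 * s ^+ 2)
  (prim_continuous (pM_continuous cf)) t0).
- move=> s _; apply: is_derive_eq (derive_monomf _ 2 s) _; lra.
- by rewrite expr0n mulr0.
move=> s /(inh _ _ t1) sh; have := sh; rewrite in_itv /= => /andP[s0 s1].
apply: (prim_le (H := fun s => 8 * s ^+ 2) (h := fun s => 16 * s)
  (pM_continuous cf) s0).
- move=> r _; apply: is_derive_eq (derive_monomf _ 1 r) _; lra.
- by rewrite expr0n mulr0.
move=> r /(inh _ _ s1) rh; have /andP[p0 p16] := p_bound rh.
by have /andP[f0 f1] := fs _ rh; rewrite mulr_ge0//= ler_pM.
Qed.

(** The bounds 0 <= f(t) <= t are preserved, since the correction is at most 8/3 t^3 <= t on the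
    half interval. They pass to the limit and make the solution comparable to [t]. *)
Lemma picard_bound n t : t \in `[0, half] ->
  t - 8 / 3 * t ^+ 3 <= picard n t <= t.
Proof.
have cube s : s \in `[0, half] -> 0 <= s ^+ 3 /\ 8 / 3 * s ^+ 3 <= s.
  by rewrite in_itv /= => /andP[s0 s1]; split; nra.
elim: n t => [|n IH] t th /=; first by have [] := cube _ th; lra.
have := @volterra_le (picard n) t (@picard_continuous n) _ th.
case/(_ _)/andP => [s sh|]; last by lra.
by have := IH s sh; have [] := cube _ sh; lra.
Qed.

Lemma picard_step n t : t \in `[0, half] ->
  `|picard n.+1 t - picard n t| <= (2 / 3) ^+ n * t.
Proof.
elim: n t => [|n IH] t th.
  rewrite expr0 mul1r; have := @picard_bound 1 t th.
  have := th; rewrite in_itv /= => /andP[t0 t1].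
  by rewrite /= ler_norml => /andP[]; nra.
rewrite -[picard n.+2 t]/(t - volterra (picard n.+1) t).
rewrite -[picard n.+1 t]/(t - volterra (picard n) t).
rewrite (_ : forall a b c : R, a - b - (a - c) = c - b); last by move=> *; ring.
rewrite distrC exprSr.
apply: volterra_dist th => //; exact: picard_continuous.
Qed.

Lemma picard_dist n k t : t \in `[0, half] ->
  `|picard (n + k) t - picard n t| <= 3 * t * (2 / 3) ^+ n.
Proof.
move=> th; have := th; rewrite in_itv /= => /andP[t0 t1].
have r0 m : 0 <= (2 / 3 : R) ^+ m by rewrite exprn_ge0.
(* The partial geometric sum is kept exact so that the induction on [k] closes. *)
suff : `|picard (n + k) t - picard n t| <=
    3 * t * ((2 / 3) ^+ n - (2 / 3) ^+ (n + k)).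
  move=> /le_trans; apply; rewrite ler_wpM2l//; first by rewrite mulr_ge0.
  by have := r0 (n + k)%N; lra.
elim: k => [|k IH]; first by rewrite addn0 !subrr normr0 mulr0.
apply: le_trans (ler_distD (picard (n + k) t) _ _) _.
have := picard_step (n + k) th; rewrite addnS exprS; lra.
Qed.

Lemma initial_value_problem : exists f f1 f2 : R -> R,
  [/\ forall x, is_derive x 1 f (f1 x), forall x, is_derive x 1 f1 (f2 x),
      continuous f2, f 0 = 0 /\ f1 0 = 1 &
      forall t, t \in `[0, half] ->
        f2 t = - p t * f t /\ t - 8 / 3 * t ^+ 3 <= f t <= t].
Proof.
have rho : 0 <= (2 / 3 : R) < 1 by apply/andP; split; lra.
have h0 : 0 <= half by rewrite invr_ge0.
have /choice[L HL] : forall t, exists l, forall n,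
    `|l - picard n (clamp 0 half t)| <= 3 * clamp 0 half t * (2 / 3) ^+ n.
  move=> t; apply: (geometric_limit (u := fun n => picard n (clamp 0 half t))).
  by move=> n k; apply: picard_dist; apply: clamp_in.
have cL : continuous L.
  move=> x; apply/continuousP_dist => e e0.
  (* The convergence is uniform: clamped points are at most 1/2, so 3/2 bounds the constant
     everywhere. *)
  have [n Hn] : exists n, 3 / 2 * (2 / 3) ^+ n < e / 3.
    apply: contrapT => /forallNP H.
    have : e / 3 <= 0.
      by apply: (le0_geometric rho (C := 3 / 2)) => n; rewrite leNgt; apply/negP/H.
    by lra.
  have /continuousP_dist/(_ (e / 3)) [|r r0 Hr] :
      {for x, continuous (picard n \o clamp 0 half)}.
  - by apply: continuous_comp; [exact: clamp_continuous|exact: picard_continuous].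
  - by lra.
  exists r => // y /Hr /= yx.
  have D z : `|L z - picard n (clamp 0 half z)| <= e / 3.
    apply: (le_trans (HL z n)); apply: le_trans (ltW Hn).
    rewrite ler_wpM2r ?exprn_ge0//.
    by have := clamp_in z h0; rewrite in_itv /= => /andP[]; lra.
  have := D x; have := D y; move: yx; rewrite !ler_norml => /andP[? ?] /andP[? ?] /andP[? ?].
  by apply/andP; split; lra.
have Lh t : t \in `[0, half] -> L t = t - volterra L t.
  move=> th; apply/eqP; rewrite -subr_eq0 -normr_le0.
  apply: (le0_geometric rho (C := 6 * t)) => n.
  have V : `|volterra L t - volterra (picard n) t| <= 3 * (2 / 3) ^+ n * (2 / 3) * t.
    apply: volterra_dist => //; first exact: picard_continuous.
    by move=> s sh; have := HL s n; rewrite clamp_id// mulrAC.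
  have := HL t n.+1; rewrite clamp_id//= exprS => W.
  have := th; rewrite in_itv /= => /andP[t0 t1].
  have z0 : 0 <= (2 / 3 : R) ^+ n by apply: exprn_ge0; lra.
  move: (volterra L t) (volterra (picard n) t) (L t) V W => u v l V W.
  have -> : l - (t - u) = l - (t - v) + (u - v) by ring.
  apply: (le_trans (ler_normD _ _)); apply: (le_trans (lerD W V)).
  by move: ((2 / 3) ^+ n) z0 => z z0; have := mulr_ge0 t0 z0; lra.
pose f2 t := - (p t * L t).
have d2 x : is_derive x 1 (fun t => 1 - prim (fun s => p s * L s) t) (f2 x).
  by have := derive_subf (derive_constf 1 x) (prim_deriv x (pM_continuous cL)); rewrite sub0r.
(* The solution is not [L] itself but the right side of its fixed-point equation: it is
   differentiable on the whole line and equals [L] on the half interval. *)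
exists (fun t => t - volterra L t), (fun t => 1 - prim (fun s => p s * L s) t), f2.
split=> //.
- move=> x; apply: derive_subf.
  exact: prim_deriv (prim_continuous (pM_continuous cL)).
- by move=> x; apply: cvgN; exact: (pM_continuous cL).
- by rewrite /volterra !prim0 !subr0.
move=> t th; rewrite -Lh// /f2 mulNr; split=> //.
have H n : [/\ t - 8 / 3 * t ^+ 3 - L t <= 3 * t * (2 / 3) ^+ n &
               L t - t <= 3 * t * (2 / 3) ^+ n].
  have := HL t n; have := picard_bound n th; rewrite clamp_id// ler_norml.
  by move=> /andP[? ?] /andP[? ?]; split; lra.
by apply/andP; split; rewrite -subr_le0;
  apply: (le0_geometric rho (C := 3 * t)) => n; case: (H n).
Qed.

End Picard.
End Shooting.

(** * Shooting to the midpoint *)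

Section Wronskian.
Variable R : realType.
Implicit Types (f g q : R -> R) (x t lam mu : R).

Local Notation half := (2^-1 : R).

Definition shoot q lam f f1 f2 : Prop :=
  [/\ forall x, is_derive x 1 f (f1 x), forall x, is_derive x 1 f1 (f2 x),
      continuous f2, f 0 = 0 /\ f1 0 = 1 &
      forall t, t \in `[0, half] ->
        f2 t = (q t - lam) * f t /\ t - 8 / 3 * t ^+ 3 <= f t <= t].

Lemma shoot_exists q lam : continuous q ->
  (forall t, t \in `[0, half] -> 0 <= q t <= 1) -> 8 <= lam <= 16 ->
  exists f f1 f2, shoot q lam f f1 f2.
Proof.
move=> cq q01 /andP[l8 l16].
have cp : continuous (fun t => lam - q t).
  by move=> x; apply: continuousB; [exact: cvg_cst|exact: cq].
have [t th|f [f1 [f2 [df df1 cf2 f0 fE]]]] := initial_value_problem cp _.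
  by have /andP[] := q01 t th; move=> ? ?; apply/andP; split; lra.
exists f, f1, f2; split=> // t th; have [-> ?] := fE t th.
by rewrite opprB.
Qed.

Lemma shoot_lower q lam f f1 f2 t : shoot q lam f f1 f2 -> t \in `[0, half] ->
  t / 3 <= f t <= t.
Proof.
move=> [_ _ _ _ fE] th; have [_ /andP[h1 ->]] := fE t th.
move: th; rewrite in_itv /= andbT => /andP[t0 t1]; apply: le_trans h1; nra.
Qed.

Lemma wronskian_deriv f f1 f2 g g1 g2 x :
  is_derive x 1 f (f1 x) -> is_derive x 1 f1 (f2 x) ->
  is_derive x 1 g (g1 x) -> is_derive x 1 g1 (g2 x) ->
  is_derive x 1 (fun y => f1 y * g y - f y * g1 y) (f2 x * g x - f x * g2 x).
Proof.
move=> df df1 dg dg1.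
apply: is_derive_eq (derive_subf (derive_mulf df1 dg) (derive_mulf df dg1)) _.
by ring.
Qed.

(** The difference is W / (f g) at 1/2, where the Wronskian W vanishes at 0 and |W'| <= |lam - mu| /
    4. There f and g are at least 1/6, so 36/8 <= 5 suffices. The bound holds for any two solutions,
    hence gives continuity in the parameter even when solutions are picked by choice. *)
Lemma shoot_logderiv q lam mu f f1 f2 g g1 g2 :
  shoot q lam f f1 f2 -> shoot q mu g g1 g2 ->
  `|f1 half / f half - g1 half / g half| <= 5 * `|lam - mu|.
Proof.
move=> Sf Sg; have := Sf; have := Sg.
move=> [dg dg1 _ [g0 g10] gE] [df df1 _ [f0 f10] fE].
pose W x := f1 x * g x - f x * g1 x.
have dW x : is_derive x 1 W (f2 x * g x - f x * g2 x) by exact: wronskian_deriv.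
have h0 : 0 <= half by rewrite invr_ge0.
have hh : half \in `[0, half] by rewrite in_itv /= h0 lexx.
have W'E x : x \in `[0, half] -> `|f2 x * g x - f x * g2 x| <= `|lam - mu| / 4.
  move=> xh; have [-> _] := fE x xh; have [-> _] := gE x xh.
  rewrite (_ : _ - _ = - (lam - mu) * (f x * g x)); last by ring.
  have /andP[f3 fx] := shoot_lower Sf xh; have /andP[g3 gx] := shoot_lower Sg xh.
  move: xh; rewrite in_itv /= => /andP[x0 x1].
  have fg : 0 <= f x * g x <= 4^-1.
    by apply/andP; split; [apply: mulr_ge0; lra|nra].
  have /andP[fg0 fg1] := fg.
  by rewrite normrM normrN (ger0_norm fg0) ler_wpM2l.
have W0 : W 0 = 0 by rewrite /W f0 g0 mulr0 mul0r subrr.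
have Wh : `|W half| <= `|lam - mu| / 8.
  have dl x : is_derive x 1 (fun y : R => `|lam - mu| / 4 * y) (`|lam - mu| / 4).
    by have := derive_scalef (`|lam - mu| / 4) (is_derive_id x 1); rewrite mulr1.
  have U : `|lam - mu| / 4 * 0 - W 0 <= `|lam - mu| / 4 * half - W half.
    apply: (@deriv_ndecr _ (fun y => `|lam - mu| / 4 * y - W y)
      (fun x => `|lam - mu| / 4 - (f2 x * g x - f x * g2 x))) => // x xh.
    by have := W'E x xh; rewrite ler_norml => /andP[]; lra.
  have L : `|lam - mu| / 4 * 0 + W 0 <= `|lam - mu| / 4 * half + W half.
    apply: (@deriv_ndecr _ (fun y => `|lam - mu| / 4 * y + W y)
      (fun x => `|lam - mu| / 4 + (f2 x * g x - f x * g2 x))) => // x xh.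
    by have := W'E x xh; rewrite ler_norml => /andP[]; lra.
  by rewrite ler_norml; move: U L; rewrite W0 => U L; apply/andP; split; lra.
have /andP[f3 _] := shoot_lower Sf hh; have /andP[g3 _] := shoot_lower Sg hh.
have f6 : 6^-1 <= f half by lra.
have g6 : 6^-1 <= g half by lra.
have fp : 0 < f half by lra.
have gp : 0 < g half by lra.
rewrite (_ : _ - _ = W half / (f half * g half)); last first.
  by rewrite /W; field; rewrite !gt_eqF.
have fg : 36^-1 <= f half * g half.
  by rewrite (_ : 36^-1 = 6^-1 * 6^-1); [apply: ler_pM|field].
rewrite normrM normfV (gtr0_norm (mulr_gt0 fp gp)) ler_pdivrMr ?mulr_gt0//.
apply: (le_trans Wh).
have := ler_wpM2l (normr_ge0 (lam - mu)) fg; have := normr_ge0 (lam - mu); lra.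
Qed.

(* [f1] vanishes at the midpoint, so that the even reflection of [f] is a
   positive Dirichlet eigenfunction. *)
Lemma ground_exists q : continuous q ->
  (forall t, t \in `[0, half] -> 0 <= q t <= 1) ->
  exists lam f f1 f2, shoot q lam f f1 f2 /\ f1 half = 0.
Proof.
move=> cq q01.
have h0 : 0 <= half by rewrite invr_ge0.
have hh : half \in `[0, half] by rewrite in_itv /= h0 lexx.
have l816 : (8 : R) <= 16 by lra.
have /choice[F HF] : forall l : R, exists F : (R -> R) * (R -> R) * (R -> R),
    shoot q (clamp 8 16 l) F.1.1 F.1.2 F.2.
  move=> l; have := clamp_in l l816; rewrite in_itv /=.
  by move=> /(shoot_exists cq q01)[f [f1 [f2 S]]]; exists (f, f1, f2).
pose m l := (F l).1.2 half / (F l).1.1 half.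
have cm : continuous m.
  move=> l; apply: (@lipschitz_continuous _ _ 5) => // k.
  apply: (le_trans (shoot_logderiv (HF k) (HF l))).
  by rewrite ler_wpM2l// clamp_dist.
have Fpos l : 0 < (F l).1.1 half.
  by have /andP[] := shoot_lower (HF l) hh; move: h0; lra.
(* At parameter 8, f'' >= - 8 t, hence f'(t) >= 1 - 4 t^2, which is 0 at 1/2. *)
have m8 : 0 <= m 8.
  rewrite /m divr_ge0//; last exact: ltW.
  have := HF 8; rewrite clamp_id ?in_itv /= ?lexx ?l816// => S8.
  have := S8 => -[df df1 _ [_ f10] fE].
  suff : (F 8).1.2 0 + 4 * 0 ^+ 2 <= (F 8).1.2 half + 4 * half ^+ 2.
    by rewrite f10 expr0n /= mulr0; lra.
  apply: (@deriv_ndecr _ (fun y => (F 8).1.2 y + 4 * y ^+ 2)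
    (fun y => (F 8).2 y + 4 * (2 * y ^+ 1))) => // x xh.
    exact: (derive_addf (df1 x) (derive_monomf 4 1 x)).
  have [-> _] := fE x xh; have /andP[x3 fx] := shoot_lower S8 xh.
  have /andP[q0 q1] := q01 x xh; move: xh; rewrite in_itv /= => /andP[x0 x1].
  by rewrite expr1; nra.
(* At parameter 16, f'' <= - 15 f <= - 15 t + 40 t^3, hence f'(t) <= 1 - 15/2 t^2 + 10 t^4, which is
   - 1/4 at 1/2. *)
have m16 : m 16 <= 0.
  rewrite /m pmulr_lle0 ?invr_gt0//.
  have := HF 16; rewrite clamp_id ?in_itv /= ?lexx ?l816// => S16.
  have := S16 => -[df df1 _ [_ f10] fE].
  suff : - (15 / 2) * 0 ^+ 2 + 10 * 0 ^+ 4 - (F 16).1.2 0 <=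
         - (15 / 2) * half ^+ 2 + 10 * half ^+ 4 - (F 16).1.2 half.
    by rewrite f10 !expr0n /= !mulr0; lra.
  apply: (@deriv_ndecr _ (fun y => - (15 / 2) * y ^+ 2 + 10 * y ^+ 4 - (F 16).1.2 y)
    (fun y => - (15 / 2) * (2 * y ^+ 1) + 10 * (4 * y ^+ 3) - (F 16).2 y)) => // x xh.
    exact: (derive_subf (derive_addf (derive_monomf _ 1 x) (derive_monomf 10 3 x)) (df1 x)).
  have [-> /andP[f1 f2]] := fE x xh; have /andP[x3 fx] := shoot_lower S16 xh.
  have /andP[q0 q1] := q01 x xh; move: xh; rewrite in_itv /= => /andP[x0 x1].
  have : 0 <= (1 - q x) * (F 16).1.1 x by apply: mulr_ge0; lra.
  by rewrite expr1; lra.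
have [||l _ ml] := @IVT R m 8 16 0 l816.
- exact: continuous_subspaceT.
- by rewrite ge_min m16 orbT le_max m8.
exists (clamp 8 16 l), (F l).1.1, (F l).1.2, (F l).2; split=> //.
move/eqP: ml; rewrite /m mulf_eq0 invr_eq0 (gt_eqF (Fpos l)) orbF.
by move/eqP.
Qed.

(** The Wronskian vanishes at 0 and at 1/2. Adding d/3 x^3 makes it nondecreasing, because f g <=
    x^2, and its total increase becomes d/24. On [[a, b]] its slope is at least m/576, because f g
    >= x^2/9 and x >= 1/8. *)
Lemma ground_gap q q' lam mu f f1 f2 g g1 g2 m a b :
  shoot q lam f f1 f2 -> shoot q' mu g g1 g2 -> f1 half = 0 -> g1 half = 0 ->
  (forall t, t \in `[0, half] -> q' t <= q t) ->
  0 < m -> 8^-1 <= a -> a < b -> b <= half ->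
  (forall t, t \in `[a, b] -> q' t + m <= q t) ->
  m * (b - a) / 24 <= lam - mu.
Proof.
move=> Sf Sg fh gh qq m0 a8 ab bh qm; have := Sf; have := Sg.
move=> [dg dg1 _ [g0 g10] gE] [df df1 _ [f0 f10] fE].
(* The sign of [lam - mu] is not yet known, and f g may be replaced by x^2 only with a nonnegative
   factor. The final bound on [d] is positive, which excludes [d = 0]. *)
pose d := Num.max 0 (lam - mu).
have d0 : 0 <= d by rewrite /d le_max lexx.
have dlm : lam - mu <= d by rewrite /d le_max lexx orbT.
pose Z x := (f1 x * g x - f x * g1 x) + d / 3 * x ^+ 3.
pose Z' x := f2 x * g x - f x * g2 x + d / 3 * (3 * x ^+ 2).
have dZ x : is_derive x 1 Z (Z' x).
  exact: (derive_addf (wronskian_deriv (df x) (df1 x) (dg x) (dg1 x)) (derive_monomf _ 2 x)).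
have Z'ge x : x \in `[0, half] -> (q x - q' x) * (f x * g x) <= Z' x.
  move=> xh; rewrite /Z'; have [-> _] := fE x xh; have [-> _] := gE x xh.
  have /andP[f3 fx] := shoot_lower Sf xh; have /andP[g3 gx] := shoot_lower Sg xh.
  move: xh; rewrite in_itv /= => /andP[x0 x1].
  have fg0 : 0 <= f x * g x by apply: mulr_ge0; lra.
  have fgx : f x * g x <= x ^+ 2 by rewrite expr2 ler_pM//; lra.
  have := ler_wpM2l d0 fgx; have := ler_wpM2r fg0 dlm; lra.
have fg0 x : x \in `[0, half] -> x ^+ 2 / 9 <= f x * g x.
  move=> xh.
  have /andP[f3 _] := shoot_lower Sf xh; have /andP[g3 _] := shoot_lower Sg xh.
  move: xh; rewrite in_itv /= => /andP[x0 x1].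
  by rewrite (_ : _ / 9 = (x / 3) * (x / 3)); [apply: ler_pM => //; lra|field].
have Z'0 x : x \in `[0, half] -> 0 <= Z' x.
  move=> xh; apply: le_trans (Z'ge x xh); apply: mulr_ge0.
    by rewrite subr_ge0 qq.
  by apply: le_trans (fg0 x xh); rewrite divr_ge0// sqr_ge0.
have sub x y z : 0 <= x -> y <= half -> z \in `[x, y] -> z \in `[0, half].
  by rewrite !in_itv /= => x0 yh /andP[xz zy]; apply/andP; split; lra.
have a0 : 0 <= a by lra.
have b0 : 0 <= b by lra.
have Z1 : Z 0 <= Z a.
  by apply: (@deriv_ndecr _ Z Z') => // x xa; apply: Z'0; apply: sub xa => //; lra.
have Z2 : Z b <= Z half.
  by apply: (@deriv_ndecr _ Z Z') => // x xa; apply: Z'0; apply: sub xa => //; lra.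
have Z3 : Z a - m / 576 * a <= Z b - m / 576 * b.
  apply: (@deriv_ndecr _ (fun x => Z x - m / 576 * x) (fun x => Z' x - m / 576)).
  - exact: ltW.
  - move=> x _; have := derive_scalef (m / 576) (is_derive_id x 1).
    by rewrite mulr1; exact: (derive_subf (dZ x)).
  move=> x xab; have xh : x \in `[0, half] by apply: sub xab.
  rewrite subr_ge0; apply: le_trans (Z'ge x xh).
  have qx := qm x xab; have := fg0 x xh.
  move: xab; rewrite in_itv /= => /andP[ax xb] fgx.
  have {}fgx : 576^-1 <= f x * g x by apply: le_trans fgx; nra.
  have i0 : 0 <= (576^-1 : R) by rewrite invr_ge0 ler0n.
  have mq : m <= q x - q' x by rewrite lerBrDl.
  exact: ler_pM (ltW m0) i0 mq fgx.
have Z00 : Z 0 = 0 by rewrite /Z f0 g0 mulr0 mul0r subrr expr0n mulr0 addr0.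
have Zh : Z half = d / 24 by rewrite /Z fh gh mul0r mulr0 subrr; field.
have mab : 0 < m * (b - a) by rewrite mulr_gt0// subr_gt0.
have dge : m * (b - a) / 24 <= d by lra.
move: dge; rewrite /d; case: (leP 0 (lam - mu)) => [_ //|_ dge]; lra.
Qed.

End Wronskian.

(** * The least eigenvalue *)

Section Glue.
Variable R : realType.
Implicit Types (f g : R -> R) (a x : R).

Definition patch_at a f g x := if x <= a then f x else g x.

Lemma patch_at_derive a f f' g g' x :
  (forall x, is_derive x 1 f (f' x)) -> (forall x, is_derive x 1 g (g' x)) ->
  f a = g a -> f' a = g' a -> is_derive x 1 (patch_at a f g) (patch_at a f' g' x).
Proof.
move=> df dg fga fga'; rewrite {2}/patch_at.
have [xa|ax|->] := ltrgtP x a.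
- apply: (@is_derive_local _ f _ _ (a - x)) => //; first by rewrite subr_gt0.
  by move=> y /ltr_distlDr; rewrite /patch_at subrKC => /ltW ->.
- apply: (@is_derive_local _ g _ _ (x - a)) => //; first by rewrite subr_gt0.
  move=> y; rewrite distrC => /ltr_distlBl; rewrite subKr /patch_at leNgt.
  by move=> ->.
- by apply: is_derive_glue => //; rewrite fga'.
Qed.

Lemma patch_at_continuous a f g : continuous f -> continuous g -> f a = g a ->
  continuous (patch_at a f g).
Proof.
move=> cf cg fga x; apply/continuousP_dist => e e0.
have /continuousP_dist/(_ e e0)[r r0 Hr] := cf x.
have /continuousP_dist/(_ e e0)[s s0 Hs] := cg x.
have [xa|ax|xa] := ltrgtP x a.
- exists (Num.min r (a - x)); first by rewrite lt_min r0 subr_gt0.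
  move=> y; rewrite lt_min => /andP[/Hr + /ltr_distlDr].
  by rewrite /patch_at subrKC (ltW xa) => + /ltW ->.
- exists (Num.min s (x - a)); first by rewrite lt_min s0 subr_gt0.
  move=> y; rewrite lt_min => /andP[/Hs gyx]; rewrite distrC => /ltr_distlBl.
  by rewrite subKr /patch_at !(leNgt _ a) ax => ->.
- exists (Num.min r s); first by rewrite lt_min r0.
  move=> y; rewrite lt_min /patch_at xa lexx => /andP[]; rewrite -xa => /Hr ? /Hs ?.
  by case: ifP => // _; rewrite xa fga -xa.
Qed.

End Glue.

(** * Comparison of eigenvalues by Picone's identity *)

Section Picone.
Variable R : realType.
Implicit Types (f q u v : R -> R) (x lam mu : R).

Lemma deriv01_continuous f (f' : R -> R) :
  (forall x, x \in `[0, 1] -> deriv01 f x (f' x)) ->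
  {within `[0, 1], continuous f}.
Proof.
move=> df; apply/subspace_continuousP => x x01.
apply/cvgrPdist_le => e e0.
have /deriv01P/(_ 1 ltr01)[r r0 Hr] := df x x01.
pose k := 1 + `|f' x|.
have k0 : 0 < k by rewrite /k ltr_pwDl.
exists (Num.min r (e / k)) => /=; first by rewrite lt_min r0 divr_gt0.
move=> y /=; rewrite lt_min !(distrC x) => /andP[yr ye] y01.
have := Hr y y01 yr; rewrite mul1r => H.
rewrite distrC; have -> : f y - f x = (f y - f x - f' x * (y - x)) + f' x * (y - x) by rewrite subrK.
apply: (le_trans (ler_normD _ _)); rewrite normrM.
apply: (@le_trans _ _ (k * `|y - x|)); first by rewrite /k mulrDl mul1r lerD2r.
by rewrite mulrC -ler_pdivlMr// ltW.
Qed.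

Lemma within_bounded f : {within `[0, 1], continuous f} ->
  exists2 K, 0 <= K & forall x, x \in `[0, 1] -> `|f x| <= K.
Proof.
move=> cf; have [c _ Hc] := EVT_max ler01 cf; have [d _ Hd] := EVT_min ler01 cf.
exists (`|f c| + `|f d|) => [|x x01]; first exact: addr_ge0.
have := Hc x x01; have := Hd x x01.
have := ler_norm (f c); have := ler_norm (- f d); rewrite normrN.
have := normr_ge0 (f c); have := normr_ge0 (f d).
by rewrite ler_norml => *; apply/andP; split; lra.
Qed.

Lemma deriv01_lipschitz f (f' : R -> R) K :
  (forall x, x \in `[0, 1] -> deriv01 f x (f' x)) ->
  (forall x, x \in `[0, 1] -> `|f' x| <= K) ->
  forall a b, 0 <= a -> a <= b -> b <= 1 -> `|f b - f a| <= K * (b - a).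
Proof.
move=> df f'K a b a0 ab b1.
have sub z : z \in `[a, b] -> z \in `[0, 1].
  by rewrite !in_itv /= => /andP[az zb]; apply/andP; split; lra.
have cf : {within `[a, b], continuous f}.
  apply: continuous_subspaceW (deriv01_continuous df) => z /=; exact: sub.
have dfo z : z \in `]a, b[ -> is_derive z 1 f (f' z).
  rewrite in_itv /= => /andP[az zb]; apply: deriv01_is_derive.
    by rewrite in_itv /=; apply/andP; split; lra.
  by apply: df; rewrite in_itv /=; apply/andP; split; lra.
have [c cab ->] := MVT_segment ab dfo cf.
by rewrite normrM (ger0_norm (_ : 0 <= b - a)) ?subr_ge0// ler_wpM2r ?subr_ge0// f'K// sub.
Qed.

(* The Picone function [v v' - v^2 u'/u] is nondecreasing when [mu <= lam], and
   tends to 0 at both ends. *)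
Lemma positive_eigenfunction_least q lam mu u u1 u2 :
  C2_01 u u1 u2 ->
  (forall x, x \in `]0, 1[ -> u2 x = (q x - lam) * u x) ->
  (forall x, x \in `]0, 1[ -> x <= 1 - x -> x / 3 <= u x) ->
  (forall x, x \in `]0, 1[ -> 1 - x <= x -> (1 - x) / 3 <= u x) ->
  sl_eigenvalue q mu -> lam <= mu.
Proof.
move=> [du du1 _] ueq ul ur [v [v1 [v2 [[dv dv1 _] [x0 x001 vx0] [v00 v10] veq]]]].
rewrite leNgt; apply/negP => mulam.
have [Kv Kv0 HKv] := within_bounded (deriv01_continuous dv1).
have [Ku Ku0 HKu] := within_bounded (deriv01_continuous du1).
have vl x : x \in `]0, 1[ -> `|v x| <= Kv * x.
  rewrite in_itv /= => /andP[x_gt0 x_lt1].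
  have := deriv01_lipschitz dv HKv (lexx 0) (ltW x_gt0) (ltW x_lt1).
  by rewrite v00 !subr0.
have vr x : x \in `]0, 1[ -> `|v x| <= Kv * (1 - x).
  rewrite in_itv /= => /andP[x_gt0 x_lt1].
  have := deriv01_lipschitz dv HKv (ltW x_gt0) (ltW x_lt1) (lexx 1).
  by rewrite v10 sub0r normrN.
have u_gt0 x : x \in `]0, 1[ -> 0 < u x.
  move=> x01; have := x01; rewrite in_itv /= => /andP[x_gt0 x_lt1].
  have [h|/ltW h] := leP x (1 - x).
    by apply: lt_le_trans (ul x x01 h); rewrite divr_gt0.
  by apply: lt_le_trans (ur x x01 h); rewrite divr_gt0// subr_gt0.
have oc x : x \in `]0, 1[ -> x \in `[0, 1] by exact: subset_itv_oo_cc.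
pose G x := v x * v1 x - v x ^+ 2 * (u1 x / u x).
(* Picone's identity: the derivative of [G] is a square plus a term that is nonnegative under the
   assumption [mu < lam]. *)
pose G' x := (v1 x - v x * (u1 x / u x)) ^+ 2 + (lam - mu) * v x ^+ 2.
have dG x : x \in `]0, 1[ -> is_derive x 1 G (G' x).
  move=> x01; have ux := u_gt0 x x01.
  have Dv := deriv01_is_derive x01 (dv x (oc x x01)).
  have Dv1 := deriv01_is_derive x01 (dv1 x (oc x x01)).
  have Du := deriv01_is_derive x01 (du x (oc x x01)).
  have Du1 := deriv01_is_derive x01 (du1 x (oc x x01)).
  have Dui : is_derive x 1 (fun y => (u y)^-1) (- (u x) ^- 2 * u1 x).
    by apply: is_deriveV; rewrite gt_eqF.
  have Dvv : is_derive x 1 (fun y => v y ^+ 2) (v1 x * v x + v x * v1 x).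
    exact: derive_mulf.
  apply: is_derive_eq (derive_subf (derive_mulf Dv Dv1)
    (derive_mulf Dvv (derive_mulf Du1 Dui))) _.
  have -> : v2 x = (q x - mu) * v x.
    by have := veq x x01; rewrite mulrBl => <-; rewrite opprD opprK addrCA subrr addr0.
  by rewrite (ueq x x01) /G'; field; rewrite gt_eqF.
pose C := Kv * (Kv + 3 * Kv * Ku).
have C0 : 0 <= C by rewrite /C mulr_ge0// addr_ge0// !mulr_ge0.
(* Near the ends [v] is at most, and [u] at least, a multiple of the distance to the boundary; so
   the quotient is bounded and [G] vanishes as fast as [v]. *)
have vu x : x \in `]0, 1[ -> `|v x| / u x <= 3 * Kv.
  move=> x01; rewrite ler_pdivrMr ?u_gt0//.
  have [h|/ltW h] := leP x (1 - x).
    apply: (le_trans (vl x x01)).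
    by have := ler_wpM2l Kv0 (ul x x01 h); lra.
  apply: (le_trans (vr x x01)).
  by have := ler_wpM2l Kv0 (ur x x01 h); lra.
have Gv x : x \in `]0, 1[ -> `|G x| <= `|v x| * (Kv + 3 * Kv * Ku).
  move=> x01; have ux := u_gt0 x x01.
  rewrite (_ : G x = v x * (v1 x - (v x / u x) * u1 x)); last first.
    by rewrite /G; ring.
  rewrite normrM ler_wpM2l//; apply: (le_trans (ler_normB _ _)).
  rewrite lerD ?HKv ?oc// normrM normrM normfV (gtr0_norm ux).
  by rewrite ler_pM// ?HKu ?oc ?vu// divr_ge0// ltW.
have Gl x : x \in `]0, 1[ -> `|G x| <= C * x.
  move=> x01; apply: (le_trans (Gv x x01)); rewrite /C [leRHS]mulrAC.
  by rewrite ler_wpM2r ?vl// addr_ge0// !mulr_ge0.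
have Gr x : x \in `]0, 1[ -> `|G x| <= C * (1 - x).
  move=> x01; apply: (le_trans (Gv x x01)); rewrite /C [leRHS]mulrAC.
  by rewrite ler_wpM2r ?vr// addr_ge0// !mulr_ge0.
have G'0 x : 0 <= G' x.
  by rewrite /G' addr_ge0 ?sqr_ge0// mulr_ge0 ?sqr_ge0// subr_ge0 ltW.
have Gm a b : 0 < a -> a <= b -> b < 1 -> G a <= G b.
  move=> a0 ab b1.
  have H x : x \in `[a, b] -> x \in `]0, 1[.
    by rewrite !in_itv /= => /andP[ax xb]; apply/andP; split; lra.
  exact: (@deriv_ndecr R G G' a b ab (fun x xab => dG x (H x xab)) (fun x _ => G'0 x)).
have G0 x : x \in `]0, 1[ -> G x = 0.
  rewrite in_itv /= => /andP[x_gt0 x_lt1]; apply/eqP; rewrite eq_le.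
  apply/andP; split; apply/ler_addgt0Pr => e e0.
    rewrite add0r.
    (* By monotonicity [G x] is at most [G y] for [y] close enough to 1 that [G y <= e]; the lower
       bound uses a point near 0. *)
    pose y := Num.max x (1 - e / (C + 1)).
    have y1 : y < 1 by rewrite /y gt_max x_lt1 ltrBlDr ltrDl divr_gt0// ltr_wpDl.
    have xy : x <= y by rewrite /y le_max lexx.
    have y01 : y \in `]0, 1[ by rewrite in_itv /= y1 (lt_le_trans x_gt0).
    apply: (le_trans (Gm x y x_gt0 xy y1)); apply: (le_trans (ler_norm _)).
    apply: (le_trans (Gr y y01)).
    have ey : 1 - y <= e / (C + 1).
      by rewrite lerBlDr -lerBlDl /y le_max lexx orbT.
    apply: (@le_trans _ _ ((C + 1) * (1 - y))).
      by rewrite ler_wpM2r ?lerDl// subr_ge0 ltW.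
    by rewrite mulrC -ler_pdivlMr// ltr_wpDl.
  rewrite -lerBlDr sub0r.
  pose y := Num.min x (e / (C + 1)).
  have y0 : 0 < y by rewrite /y lt_min x_gt0 divr_gt0// ltr_wpDl.
  have yx : y <= x by rewrite /y ge_min lexx.
  have y01 : y \in `]0, 1[ by rewrite in_itv /= y0 (le_lt_trans yx).
  apply: le_trans (Gm y x y0 yx x_lt1); rewrite lerNl.
  apply: (le_trans (ler_norm _)); rewrite normrN.
  apply: (le_trans (Gl y y01)).
  apply: (@le_trans _ _ ((C + 1) * y)); first by rewrite ler_wpM2r ?lerDl// ltW.
  by rewrite mulrC -ler_pdivlMr ?ltr_wpDl// /y ge_min lexx orbT.
have {}x001 : x0 \in `]0, 1[.
  move: x001 vx0; rewrite !in_itv /= => /andP[x0_ge0 x0_le1] vx0.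
  rewrite !lt_neqAle x0_ge0 x0_le1 !andbT; apply/andP; split; apply/eqP => E.
    by rewrite -E v00 eqxx in vx0.
  by rewrite E v10 eqxx in vx0.
have [_ G'E] := dG x0 x001.
(* [G] is identically 0, while its derivative at [x0] is at least [(lam - mu) * v x0 ^+ 2], which is
   positive. *)
have : is_derive x0 1 G 0.
  have := x001; rewrite in_itv /= => /andP[x0_gt0 x0_lt1].
  apply: (@is_derive_local _ (fun=> 0) _ _ (Num.min x0 (1 - x0))).
  - by rewrite lt_min x0_gt0 subr_gt0.
  - move=> y; rewrite lt_min => /andP[]; rewrite !ltr_norml => /andP[? ?] /andP[? ?].
    by rewrite G0// in_itv /=; apply/andP; split; lra.
move=> [_]; rewrite G'E => G'x0.
have : 0 < G' x0.
  rewrite /G' ltr_wpDl ?sqr_ge0// mulr_gt0 ?subr_gt0//.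
  by rewrite exprn_even_gt0.
by rewrite G'x0 ltxx.
Qed.

Lemma ground_lambda q lam f f1 f2 : (forall x, q (1 - x) = q x) ->
  shoot q lam f f1 f2 -> f1 2^-1 = 0 -> lambda q = lam.
Proof.
move=> qsym Sf fh; have := Sf => -[df df1 cf2 [f0 f10] fE].
have hE : 1 - 2^-1 = 2^-1 :> R by field.
pose u := patch_at 2^-1 f (fun x => f (1 - x)).
pose u1 := patch_at 2^-1 f1 (fun x => - f1 (1 - x)).
pose u2 := patch_at 2^-1 f2 (fun x => f2 (1 - x)).
have du x : is_derive x 1 u (u1 x).
  apply: patch_at_derive => //; rewrite ?hE ?fh ?oppr0// => y.
  exact: deriv_reflect.
have du1 x : is_derive x 1 u1 (u2 x).
  apply: patch_at_derive => //; rewrite ?hE ?fh ?oppr0// => y.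
  by apply: is_derive_eq (is_deriveN (deriv_reflect (df1 (1 - y)))) (opprK _).
have cu2 : continuous u2.
  apply: patch_at_continuous => //; last by rewrite hE.
  move=> x; apply: (@continuous_comp _ _ _ (fun y : R => 1 - y) f2).
    by apply: continuousB; [exact: cvg_cst|exact: cvg_id].
  exact: cf2.
have C2u : C2_01 u u1 u2.
  split=> [x _|x _|]; [exact: is_derive_deriv01|exact: is_derive_deriv01|].
  exact: continuous_subspaceT.
have ueq x : x \in `]0, 1[ -> u2 x = (q x - lam) * u x.
  rewrite in_itv /= => /andP[x0 x1]; rewrite /u2 /u /patch_at.
  have [xh|hx] := leP x 2^-1.
    by have [|-> _] := fE x; first by rewrite in_itv /= xh ltW.
  have [|-> _] := fE (1 - x); last by rewrite qsym.
  by rewrite in_itv /=; apply/andP; split; lra.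
have ul x : x \in `]0, 1[ -> x <= 1 - x -> x / 3 <= u x.
  rewrite in_itv /= => /andP[x0 x1] xx; have xh : x <= 2^-1 by lra.
  have xi : x \in `[0, 2^-1] by rewrite in_itv /= xh ltW.
  by rewrite /u /patch_at xh; have /andP[] := shoot_lower Sf xi.
have ur x : x \in `]0, 1[ -> 1 - x <= x -> (1 - x) / 3 <= u x.
  rewrite in_itv /= => /andP[x0 x1] xx.
  have xh : 1 - x \in `[0, 2^-1] by rewrite in_itv /=; apply/andP; split; lra.
  have /andP[H _] := shoot_lower Sf xh.
  (* The only such point in the left branch is the midpoint, where both branches agree. *)
  rewrite /u /patch_at; case: (leP x 2^-1) => // hx.
  have xe : x = 2^-1 by lra.
  by move: H; rewrite xe hE.
have eig : sl_eigenvalue q lam.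
  exists u, u1, u2; split=> //.
  - exists 2^-1; first by rewrite in_itv /=; apply/andP; split; lra.
    rewrite gt_eqF//.
    have h01 : (2^-1 : R) \in `]0, 1[ by rewrite in_itv /=; apply/andP; split; lra.
    by apply: lt_le_trans (ul _ h01 _); lra.
  - by rewrite /u /patch_at invr_ge0 ler0n subrr f0; case: ifP => //; lra.
  - by move=> x /ueq ->; ring.
have least : lbound (sl_eigenvalue q) lam.
  by move=> mu; exact: (positive_eigenfunction_least C2u ueq ul ur).
(* The least eigenvalue just exhibited rules out the default value 0 of [xget], and two least
   elements coincide. *)
rewrite /lambda; case: xgetP => [l _ [el ll]|/(_ lam)]; last by case.
by apply/eqP; rewrite eq_le ll// least.
Qed.

End Picone.

(** * Bumps *)

Section DisjointSums.
Variable R : realType.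

Lemma derive_sumf n (F F' : 'I_n -> R -> R) (x : R) :
  (forall i, is_derive x 1 (F i) (F' i x)) ->
  is_derive x 1 (fun y => \sum_i F i y) (\sum_i F' i x).
Proof. by move=> dF; have := is_derive_sum dF; rewrite fct_sumE. Qed.

Lemma continuous_sumf n (F : 'I_n -> R -> R) :
  (forall i, continuous (F i)) -> continuous (fun y => \sum_i F i y).
Proof.
move=> cF; rewrite -fct_sumE; elim/big_ind: _ => [x|f g cf cg x|i _].
- exact: cvg_cst.
- by apply: continuousD; [exact: cf|exact: cg].
- exact: cF.
Qed.

Lemma disjoint_sum_bound n (F : 'I_n -> R) (K : R) (S : pred 'I_n) : 0 <= K ->
  (forall i j, S i -> S j -> i = j) -> (forall i, ~~ S i -> F i = 0) ->
  (forall i, `|F i| <= K) -> `|\sum_i F i| <= K.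
Proof.
move=> K0 Suniq F0 FK; have [i Si|S0] := pickP S.
  rewrite (bigD1 i)//= big1 ?addr0// => j ji; apply: F0.
  by apply: contraNN ji => Sj; rewrite (Suniq j i).
by rewrite big1 ?normr0// => i _; rewrite F0// S0.
Qed.

End DisjointSums.

(** * Truncated powers and twice differentiable bumps *)

Section Bump.
Variable R : realType.
Implicit Types (a h s t x : R).

(** The truncated power; exponent 3 is what gives the bumps a continuous second derivative. *)
Definition ppow k x : R := patch_at 0 (fun=> 0) (fun y => y ^+ k) x.

Lemma ppowE k x : ppow k x = if x <= 0 then 0 else x ^+ k.
Proof. by []. Qed.

Lemma ppow_ge0 k x : 0 <= ppow k x.
Proof. by rewrite ppowE; case: (leP x 0) => // /ltW x0; rewrite exprn_ge0. Qed.

Lemma ppow_le k x b : 0 <= b -> x <= b -> ppow k x <= b ^+ k.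
Proof.
move=> b0 xb; rewrite ppowE; case: (leP x 0) => [_|x0]; first exact: exprn_ge0.
by apply: lerXn2r => //; rewrite nnegrE// ltW.
Qed.

Lemma ppow_derive k x : is_derive x 1 (ppow k.+2) (k.+2%:R * ppow k.+1 x).
Proof.
have := @patch_at_derive R 0 (fun=> 0) (fun=> 0) (fun y => y ^+ k.+2)
  (fun y => k.+2%:R * y ^+ k.+1) x.
rewrite !expr0n mulr0 => /(_ (fun x => derive_constf 0 x) (derive_powf _) erefl erefl).
by rewrite /ppow /patch_at; case: ifP => // _; rewrite mulr0.
Qed.

Lemma ppow1_continuous : continuous (ppow 1).
Proof.
apply: patch_at_continuous; rewrite ?expr0n// => x; first exact: cvg_cst.
exact: exprn_continuous.
Qed.

Definition bump_arg a h s : R := (s - a) * (a + h - s).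
Definition bumpf c a h s : R := c * ppow 3 (bump_arg a h s).
Definition bumpf1 c a h s : R :=
  c * (3 * ppow 2 (bump_arg a h s) * (a *+ 2 + h - s *+ 2)).
Definition bumpf2 c a h s : R :=
  c * (6 * ppow 1 (bump_arg a h s) * (a *+ 2 + h - s *+ 2) ^+ 2 -
       6 * ppow 2 (bump_arg a h s)).

Lemma bump_arg_derive a h s : is_derive s 1 (bump_arg a h) (a *+ 2 + h - s *+ 2).
Proof.
have := derive_mulf (derive_subf (is_derive_id s 1) (derive_constf a s))
  (derive_subf (derive_constf (a + h) s) (is_derive_id s 1)).
by move=> H; apply: (is_derive_eq H); rewrite !mulr2n; ring.
Qed.

Lemma bump_arg1_derive a h s : is_derive s 1 (fun s => a *+ 2 + h - s *+ 2) (- 2).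
Proof.
have := derive_subf (derive_constf (a *+ 2 + h) s)
  (derive_addf (is_derive_id s 1) (is_derive_id s 1)).
by move=> H; apply: (is_derive_eq H); ring.
Qed.

Lemma ppow_bump_derive k a h s :
  is_derive s 1 (fun s => ppow k.+2 (bump_arg a h s))
    (k.+2%:R * ppow k.+1 (bump_arg a h s) * (a *+ 2 + h - s *+ 2)).
Proof.
exact: (is_derive1_comp (ppow_derive k (bump_arg a h s)) (bump_arg_derive a h s)).
Qed.

Lemma bump_derive c a h s : is_derive s 1 (bumpf c a h) (bumpf1 c a h s).
Proof. exact: (derive_scalef c (ppow_bump_derive 1 a h s)). Qed.

Lemma bump1_derive c a h s : is_derive s 1 (bumpf1 c a h) (bumpf2 c a h s).
Proof.
have := derive_scalef c (derive_mulf (derive_scalef 3 (ppow_bump_derive 0 a h s))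
  (bump_arg1_derive a h s)).
by move=> H; apply: (is_derive_eq H); rewrite /bumpf2; ring.
Qed.

Lemma bump2_continuous c a h : continuous (bumpf2 c a h).
Proof.
have ca : continuous (bump_arg a h).
  by move=> s; exact: is_derive_continuous (bump_arg_derive a h s).
have cp k : continuous (fun s => ppow k.+1 (bump_arg a h s)).
  case: k => [|k] s; last exact: is_derive_continuous (ppow_bump_derive k a h s).
  by apply: (@continuous_comp _ _ _ (bump_arg a h) (ppow 1));
    [exact: ca|exact: ppow1_continuous].
have cl : continuous (fun s => a *+ 2 + h - s *+ 2).
  by move=> s; exact: is_derive_continuous (bump_arg1_derive a h s).
move=> s; rewrite /continuous_at /bumpf2.
apply: cvgM; first exact: cvg_cst.
apply: cvgB; last by apply: cvgM; [exact: cvg_cst|exact: cp].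
apply: cvgM; first by apply: cvgM; [exact: cvg_cst|exact: cp].
by apply: cvgM; exact: cl.
Qed.

Lemma bump_arg_le0 a h s : 0 <= h -> ~~ (a < s < a + h) -> bump_arg a h s <= 0.
Proof.
move=> h0; rewrite negb_and -!leNgt /bump_arg => /orP[H|H].
  by apply: mulr_le0_ge0; lra.
by apply: mulr_ge0_le0; lra.
Qed.

Lemma bump_out c a h s : 0 <= h -> ~~ (a < s < a + h) ->
  [/\ bumpf c a h s = 0, bumpf1 c a h s = 0 & bumpf2 c a h s = 0].
Proof.
move=> h0 /(bump_arg_le0 h0) w0.
by rewrite /bumpf /bumpf1 /bumpf2 !ppowE w0 !mulr0 !mul0r subrr mulr0.
Qed.

(** The second derivative is of order [c * h ^+ 4], which fixes [c]. The bounds 1/2 and 1/4 leave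
    room for the substitution s = t (1 - t): the second derivative in t is then at most 1/2 + 2/4 =
    1. *)
Lemma bump_bound a h s : 0 < h -> h <= 1 -> let c := (4 * h ^+ 4)^-1 in
  [/\ 0 <= bumpf c a h s <= 1, `|bumpf1 c a h s| <= 4^-1 & `|bumpf2 c a h s| <= 2^-1].
Proof.
move=> h0 h1 c; have [sin|sout] := boolP (a < s < a + h); last first.
  have [-> -> ->] := bump_out c (ltW h0) sout.
  by rewrite normr0 lexx ler01 !invr_ge0 !ler0n.
have c0 : 0 < c by rewrite invr_gt0 mulr_gt0// exprn_gt0.
have ch : c * h ^+ 4 = 4^-1.
  by rewrite /c; field; rewrite gt_eqF.
have /andP[sa_gt sa_lt] := sin.
pose w := bump_arg a h s; pose l := a *+ 2 + h - s *+ 2.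
have lh : l ^+ 2 <= h ^+ 2 by rewrite /l !mulr2n; nra.
have ln : `|l| <= h by rewrite ler_norml /l !mulr2n; apply/andP; split; lra.
have wh : w <= h ^+ 2 / 4.
  have : w = (h ^+ 2 - l ^+ 2) / 4 by rewrite /w /l /bump_arg; field.
  by move=> ->; have := sqr_ge0 l; lra.
have b0 : 0 <= h ^+ 2 / 4 by rewrite divr_ge0// sqr_ge0.
have p1 := ppow_le 1 b0 wh; have p2 := ppow_le 2 b0 wh; have p3 := ppow_le 3 b0 wh.
have q1 := ppow_ge0 1 w; have q2 := ppow_ge0 2 w; have q3 := ppow_ge0 3 w.
have h41 : h ^+ 4 <= h ^+ 2 * 1 by rewrite -[4%N]/(2 + 2)%N exprD ler_wpM2l ?sqr_ge0// expr_le1// ltW.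
have h21 : h ^+ 2 <= 1 by rewrite expr_le1// ltW.
split.
- rewrite /bumpf mulr_ge0 ?(ltW c0)//=.
  apply: (@le_trans _ _ (c * h ^+ 4)); last by rewrite ch; lra.
  rewrite ler_pM2l//; apply: (le_trans p3).
  rewrite (_ : _ ^+ 3 = h ^+ 4 * (h ^+ 2 / 64)); last by field.
  by rewrite ler_piMr ?exprn_ge0 ?(ltW h0)//; lra.
- rewrite /bumpf1 -/w -/l normrM (gtr0_norm c0) -ch ler_pM2l//.
  rewrite !normrM (ger0_norm q2) ger0_norm//.
  apply: (@le_trans _ _ (3 * (h ^+ 2 / 4) ^+ 2 * 1)).
    apply: ler_pM => //; [by rewrite mulr_ge0| by rewrite ler_wpM2l|].
    exact: le_trans ln h1.
  rewrite (_ : _ * 1 = h ^+ 4 * (3 / 16)); last by field.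
  by rewrite ler_piMr ?exprn_ge0 ?(ltW h0)//; lra.
rewrite /bumpf2 -/w -/l normrM (gtr0_norm c0).
rewrite (_ : 2^-1 = c * (2 * h ^+ 4)); last by rewrite mulrCA ch; field.
rewrite ler_pM2l//.
have L1 : 6 * ppow 1 w * l ^+ 2 <= 6 * (h ^+ 2 / 4) ^+ 1 * h ^+ 2.
  by apply: ler_pM => //; [by rewrite mulr_ge0|exact: sqr_ge0|rewrite ler_wpM2l].
have L0 : 0 <= 6 * ppow 1 w * l ^+ 2 by apply: mulr_ge0; [exact: mulr_ge0|exact: sqr_ge0].
have E1 : 6 * (h ^+ 2 / 4) ^+ 1 * h ^+ 2 = 3 / 2 * h ^+ 4 by field.
have E2 : (h ^+ 2 / 4) ^+ 2 = h ^+ 4 / 16 by field.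
have h4 : 0 <= h ^+ 4 by rewrite exprn_ge0// ltW.
rewrite E1 in L1; rewrite E2 in p2.
by rewrite ler_norml; apply/andP; split; lra.
Qed.

(** On the middle half the argument is at least 1/4 * 3/4 * h^2, and (3/16)^3 / 4 >= 1/640. *)
Lemma bump_mid a h s : 0 < h -> a + h / 4 <= s <= a + 3 / 4 * h ->
  h ^+ 2 / 640 <= bumpf (4 * h ^+ 4)^-1 a h s.
Proof.
move=> h0 /andP[s1 s2].
have w0 : 3 / 16 * h ^+ 2 <= bump_arg a h s by rewrite /bump_arg; nra.
have wp : 0 < bump_arg a h s.
  by apply: lt_le_trans w0; rewrite mulr_gt0 ?exprn_gt0//; lra.
rewrite /bumpf ppowE (leNgt _ 0) wp /= [leRHS]mulrC ler_pdivlMr; last first.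
  by rewrite mulr_gt0// exprn_gt0.
apply: (@le_trans _ _ ((3 / 16 * h ^+ 2) ^+ 3)); last first.
  apply: lerXn2r => //; rewrite nnegrE ?(ltW wp)//.
  by rewrite mulr_ge0 ?sqr_ge0//; lra.
have h6 : 0 <= h ^+ 6 by rewrite exprn_ge0// ltW.
rewrite (_ : _ * (4 * _) = h ^+ 6 / 160); last by field.
rewrite (_ : _ ^+ 3 = h ^+ 6 * (27 / 4096)); last by field.
by lra.
Qed.

End Bump.

(** * The hard family of potentials *)

Section HardFamily.
Variables (R : realType) (n : nat).
Hypothesis n_gt0 : (0 < n)%N.
Implicit Types (x : {ffun 'I_n -> bool}) (i j : 'I_n) (s t : R).

(** The bumps live in the variable s = t (1 - t), which makes the potentials even about 1/2. Their
    [n] intervals of length [h] tile [1/8, 3/16], away from the boundary and from the critical value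
    1/4. *)
Let h : R := (16 * n%:R)^-1.
Let c : R := (4 * h ^+ 4)^-1.
Let a i : R := 8^-1 + i%:R * h.

Lemma width_gt0 : 0 < h. Proof. by rewrite invr_gt0 mulr_gt0// ltr0n. Qed.

Lemma width_le1 : h <= 1.
Proof. by rewrite invf_le1 ?mulr_gt0 ?ltr0n//; have : 1 <= n%:R :> R; [rewrite ler1n|lra]. Qed.

Lemma bump_range i : 8^-1 <= a i /\ a i + h <= 3 / 16.
Proof.
rewrite /a; split; first by rewrite lerDl mulr_ge0// ltW// width_gt0.
have : i%:R + 1 <= n%:R :> R by rewrite natr1 ler_nat.
move=> /(ler_wpM2r (ltW width_gt0)).
by rewrite (_ : n%:R * h = 16^-1) ?mulrDl; [lra|rewrite /h; field; rewrite pnatr_eq0 -lt0n].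
Qed.

Definition bump_supp i t : bool := (a i < t * (1 - t) < a i + h).

Lemma bump_supp_disjoint i j t : bump_supp i t -> bump_supp j t -> i = j.
Proof.
move=> /andP[i1 i2] /andP[j1 j2]; apply: val_inj; apply/eqP.
have lt1 (k l : 'I_n) : a k < a l + h -> (k <= l)%N.
  rewrite /a -addrA ltrD2l -{3}[h]mul1r -mulrDl (ltr_pM2r width_gt0).
  by rewrite natr1 ltr_nat ltnS.
by rewrite eqn_leq !lt1// ?(lt_trans i1)// ?(lt_trans j1).
Qed.

Let part (F : R -> R -> R -> R -> R) x i s := (x i)%:R * F c (a i) h s.
Let bump_sum F x s := \sum_i part F x i s.

Definition hard_q x t : R := bump_sum (@bumpf R) x (t * (1 - t)).
Let hard_q1 x t : R := bump_sum (@bumpf1 R) x (t * (1 - t)) * (1 - t *+ 2).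
Let hard_q2 x t : R :=
  bump_sum (@bumpf2 R) x (t * (1 - t)) * (1 - t *+ 2) * (1 - t *+ 2) +
  bump_sum (@bumpf1 R) x (t * (1 - t)) * (- 2).

Lemma bump_sum_bound F K x t : 0 <= K ->
  (forall i s, ~~ (a i < s < a i + h) -> F c (a i) h s = 0) ->
  (forall i s, `|F c (a i) h s| <= K) -> `|bump_sum F x (t * (1 - t))| <= K.
Proof.
move=> K0 F0 FK; apply: (@disjoint_sum_bound _ _ _ _ (fun i => bump_supp i t)) => //.
- by move=> i j; exact: bump_supp_disjoint.
- by move=> i Si; rewrite /part F0 ?mulr0.
- move=> i; rewrite /part normrM normr_nat; case: (x i); first by rewrite mul1r.
  by rewrite mul0r.
Qed.

Lemma hard_q_bound x t : 0 <= hard_q x t <= 1.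
Proof.
have B i s := bump_bound (a i) s width_gt0 width_le1.
apply/andP; split.
  apply: sumr_ge0 => i _; rewrite /part mulr_ge0 ?ler0n//.
  by have [/andP[]] := B i (t * (1 - t)).
apply: (le_trans (ler_norm _)); apply: bump_sum_bound => // i s.
  by move=> out; have [] := bump_out c (ltW width_gt0) out.
by have [/andP[b0 b1] _ _] := B i s; rewrite ger0_norm.
Qed.

Lemma hard_q_sym x t : hard_q x (1 - t) = hard_q x t.
Proof. by rewrite /hard_q subKr mulrC. Qed.

Lemma parabola_derive t : is_derive t 1 (fun t => t * (1 - t)) (1 - t *+ 2).
Proof.
have := derive_mulf (is_derive_id t 1)
  (derive_subf (derive_constf 1 t) (is_derive_id t 1)).
by move=> H; apply: (is_derive_eq H); ring.
Qed.

Lemma slope_derive t : is_derive t 1 (fun t => 1 - t *+ 2) (- 2).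
Proof.
have := derive_subf (derive_constf 1 t)
  (derive_addf (is_derive_id t 1) (is_derive_id t 1)).
by move=> H; apply: (is_derive_eq H); ring.
Qed.

Lemma bump_sum_derive (F F' : R -> R -> R -> R -> R) x t :
  (forall i s, is_derive s 1 (F c (a i) h) (F' c (a i) h s)) ->
  is_derive t 1 (fun t => bump_sum F x (t * (1 - t)))
    (bump_sum F' x (t * (1 - t)) * (1 - t *+ 2)).
Proof.
move=> dF; apply: (@is_derive1_comp _ (bump_sum F x) (fun t => t * (1 - t))).
  by apply: derive_sumf => i; exact: derive_scalef.
exact: parabola_derive.
Qed.

Lemma hard_q_derive x t : is_derive t 1 (hard_q x) (hard_q1 x t).
Proof. by apply: bump_sum_derive => i s; exact: bump_derive. Qed.

Lemma hard_q_continuous x : continuous (hard_q x).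
Proof. by move=> t; exact: is_derive_continuous (hard_q_derive x t). Qed.

Lemma hard_q_class x : class_Q (hard_q x).
Proof.
have B i s := bump_bound (a i) s width_gt0 width_le1.
have O i s := @bump_out R c (a i) h s (ltW width_gt0).
have d1 t : is_derive t 1 (fun t => bump_sum (@bumpf1 R) x (t * (1 - t)))
    (bump_sum (@bumpf2 R) x (t * (1 - t)) * (1 - t *+ 2)).
  by apply: bump_sum_derive => i s; exact: bump1_derive.
have cs : continuous (fun t : R => t * (1 - t)).
  by move=> t; exact: is_derive_continuous (parabola_derive t).
have cl : continuous (fun t : R => 1 - t *+ 2).
  by move=> t; exact: is_derive_continuous (slope_derive t).
have ct2 : continuous (fun t => bump_sum (@bumpf2 R) x (t * (1 - t))).
  move=> t; apply: (@continuous_comp _ _ _ (fun t : R => t * (1 - t))); first exact: cs.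
  apply: continuous_sumf => i s; rewrite /part /continuous_at.
  by apply: cvgM; [exact: cvg_cst|exact: bump2_continuous].
split=> [t _|]; first exact: hard_q_bound.
exists (hard_q1 x), (hard_q2 x); split.
  split=> [t _|t _|].
  - exact: is_derive_deriv01 (hard_q_derive x t).
  - exact: is_derive_deriv01 (derive_mulf (d1 t) (slope_derive t)).
  apply: continuous_subspaceT => t; rewrite /continuous_at /hard_q2.
  apply: cvgD; last first.
    by apply: cvgM; [exact: is_derive_continuous (d1 t)|exact: cvg_cst].
  by apply: cvgM; [apply: cvgM; [exact: ct2|exact: cl]|exact: cl].
move=> t; rewrite in_itv /= => /andP[t0 t1].
have lt1 : `|1 - t *+ 2| <= 1 by rewrite ler_norml mulr2n; apply/andP; split; lra.
have T1 : `|bump_sum (@bumpf1 R) x (t * (1 - t))| <= 4^-1.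
  by apply: bump_sum_bound => [|i s /O[]|i s] //; have [] := B i s.
have T2 : `|bump_sum (@bumpf2 R) x (t * (1 - t))| <= 2^-1.
  by apply: bump_sum_bound => [|i s /O[]|i s] //; have [] := B i s.
split.
- by have /andP[q0 q1] := hard_q_bound x t; rewrite ger0_norm.
- rewrite /hard_q1 normrM -[leRHS]mulr1 ler_pM//; apply: (le_trans T1); lra.
rewrite /hard_q2; apply: (le_trans (ler_normD _ _)).
have n2 : `|- 2| = 2 :> R by rewrite normrN ger0_norm.
rewrite !normrM n2.
have P1 : `|bump_sum (@bumpf2 R) x (t * (1 - t))| * `|1 - t *+ 2| * `|1 - t *+ 2| <=
    2^-1 * 1 * 1 by rewrite !ler_pM// mulr_ge0.
have P2 : `|bump_sum (@bumpf1 R) x (t * (1 - t))| * 2 <= 4^-1 * 2 by rewrite ler_wpM2r.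
lra.
Qed.

Lemma hard_q_local x i t : ~~ bump_supp i t ->
  hard_q x t = hard_q (flip i x) t.
Proof.
move=> out; apply: eq_bigr => j _; rewrite /part.
have [->|ji] := eqVneq j i; last by rewrite /flip ffunE (negbTE ji) addbF.
by have [-> _ _] := bump_out c (ltW width_gt0) out; rewrite !mulr0.
Qed.

Lemma hard_q_flip x i t : x i ->
  hard_q x t = hard_q (flip i x) t + bumpf c (a i) h (t * (1 - t)).
Proof.
move=> xi; rewrite /hard_q /bump_sum (bigD1 i)//= [in RHS](bigD1 i)//=.
rewrite /part ffunE xi eqxx mul1r mul0r add0r addrC; congr (_ + _).
by apply: eq_bigr => j ji; rewrite ffunE (negbTE ji) addbF.
Qed.

(** The smaller root of t (1 - t) = s; it carries the middle half of a bump back to an interval of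
    [0, 1/2]. *)
Definition parabola_inv s : R := (1 - Num.sqrt (1 - 4 * s)) / 2.

Lemma parabola_invP s : 0 <= s -> s <= 4^-1 ->
  [/\ parabola_inv s * (1 - parabola_inv s) = s, s <= parabola_inv s &
      parabola_inv s <= 2^-1].
Proof.
move=> s0 s1; rewrite /parabola_inv; set r := Num.sqrt _.
have rr : r ^+ 2 = 1 - 4 * s by rewrite sqr_sqrtr//; lra.
have r0 : 0 <= r by exact: sqrtr_ge0.
have e : (1 - r) / 2 * (1 - (1 - r) / 2) = s.
  by transitivity ((1 - r ^+ 2) / 4); [field|rewrite rr; field].
split=> //; last lra.
have := sqr_ge0 ((1 - r) / 2); rewrite expr2; move: e; lra.
Qed.

(** [ground_gap] is applied on the middle half of the bump, of height at least [h ^+ 2 / 640] and of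
    length at least [h / 2] in t. *)
Lemma hard_q_gap_on x i : x i ->
  h ^+ 3 / (48 * 640) <= lambda (hard_q x) - lambda (hard_q (flip i x)).
Proof.
move=> xi.
have [l [f [f1 [f2 [Sf fh]]]]] := ground_exists (@hard_q_continuous x)
  (fun t _ => hard_q_bound x t).
have [m [g [g1 [g2 [Sg gh]]]]] := ground_exists (@hard_q_continuous (flip i x))
  (fun t _ => hard_q_bound (flip i x) t).
rewrite (ground_lambda (hard_q_sym x) Sf fh).
rewrite (ground_lambda (hard_q_sym (flip i x)) Sg gh).
have [a8 ah] := bump_range i; have h0 := width_gt0.
have [e1 l1 u1] := @parabola_invP (a i + h / 4) ltac:(lra) ltac:(lra).
have [e2 l2 u2] := @parabola_invP (a i + 3 / 4 * h) ltac:(lra) ltac:(lra).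
set b1 := parabola_inv _ in e1 l1 u1; set b2 := parabola_inv _ in e2 l2 u2.
have b12 : b1 < b2.
  have : 0 < (b2 - b1) * (1 - b1 - b2).
    by rewrite (_ : _ * _ = h / 2); [rewrite divr_gt0|move: e1 e2; lra].
  rewrite !ltNge; apply: contra => b21.
  by apply: mulr_le0_ge0; move: u1 u2 b21; lra.
(* The map t (1 - t) has slope at most 1, so pulling back does not shorten the interval. *)
have bh : h / 2 <= b2 - b1.
  have : 0 <= (b2 - b1) * (b1 + b2) by apply: mulr_ge0; move: l1 b12; lra.
  by move: e1 e2; lra.
have p640 : 0 < 640 :> R by rewrite ltr0n.
have m0 : 0 < h ^+ 2 / 640 := divr_gt0 (exprn_gt0 2 h0) p640.
apply: le_trans (ground_gap Sf Sg fh gh _ m0 _ b12 u2 _).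
- rewrite (_ : _ / (48 * 640) = h ^+ 2 / 640 * (h / 2) / 24); last by field.
  by rewrite ler_pM2r ?invr_gt0// ler_pM2l.
- move=> t _; rewrite (hard_q_flip _ xi) lerDl.
  by have [/andP[]] := bump_bound (a i) (t * (1 - t)) h0 width_le1.
- by apply: le_trans l1; lra.
move=> t; rewrite in_itv /= => /andP[t1 t2].
rewrite (hard_q_flip _ xi) lerD2l; apply: bump_mid => //.
(* This product is t (1 - t) - b1 (1 - b1), and the next is b2 (1 - b2) - t (1 - t). *)
have p1 : 0 <= (t - b1) * (1 - b1 - t) by apply: mulr_ge0; move: u2 t1 t2; lra.
have p2 : 0 <= (b2 - t) * (1 - b2 - t) by apply: mulr_ge0; move: u2 t1 t2; lra.
by apply/andP; split; move: e1 e2 p1 p2; lra.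
Qed.

Lemma hard_q_gap x i :
  h ^+ 3 / (48 * 640) <= `|lambda (hard_q x) - lambda (hard_q (flip i x))|.
Proof.
have [xi|xi] := boolP (x i).
  exact: le_trans (hard_q_gap_on xi) (ler_norm _).
rewrite distrC -{2}(flipK i x); apply: le_trans (ler_norm _).
by apply: hard_q_gap_on; rewrite ffunE eqxx (negbTE xi).
Qed.

End HardFamily.

(** * The lower bound *)

(** With [z] the number of bumps, the right side is the gap of [hard_q_gap]; the second premise says
    that [z] is at most d eps^(-1/3). *)
Lemma precision_bound (R : realType) (eps d z : R) : 0 < eps -> 0 < z ->
  eps * z ^+ 3 <= d ^+ 3 -> 2 * (48 * 640) * (16 * d) ^+ 3 < 1 ->
  2 * eps < (16 * z)^-1 ^+ 3 / (48 * 640).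
Proof.
move=> e0 z0 ez d1; have k0 : 0 < 16 * z by rewrite mulr_gt0.
have [K0 L0] : 0 < 48 * 640 :> R /\ 0 < 16 ^+ 3 :> R.
  by rewrite mulr_gt0 ?ltr0n// exprn_gt0 ?ltr0n.
have k3 := exprn_gt0 3 k0.
rewrite (ltr_pdivlMr _ _ K0) exprVn -[X in _ < X]mul1r.
rewrite (ltr_pdivlMr _ _ k3); move: d1; rewrite !exprMn.
move: (48 * 640) (16 ^+ 3) K0 L0 => K L K0 L0; apply: le_lt_trans.
rewrite (_ : 2 * eps * K * (L * z ^+ 3) = 2 * K * L * (eps * z ^+ 3)); last by ring.
by rewrite [leRHS]mulrA ler_pM2l// !mulr_gt0.
Qed.

Theorem theorem5p1 (R : realType) :
  exists2 c : R, 0 < c &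
    \forall eps \near (0 : R)^'+,
      ((c * eps `^ (- (1 / 3)))%:E <= n_bit_query eps)%E.
Proof.
(* Small enough that 2 * 48 * 640 * (16 d)^3 < 1. *)
pose d : R := 10^-1 * 10^-1 * 10^-1.
have d0 : 0 < d by rewrite /d; lra.
(* A factor 32 comes from [adversary_bound], and a factor 2 from rounding [d * y] down, as
   [d * y >= 2]. *)
exists (d / 64); first by rewrite divr_gt0.
near=> eps.
have e0 : 0 < eps by [].
have eps_small : eps < (d / 2) ^+ 3.
  by near: eps; apply: nbhs_right_lt; rewrite exprn_gt0// divr_gt0.
set y := eps `^ _.
have y0 : 0 < y by exact: powR_gt0.
have y3 : y ^+ 3 = eps^-1.
  rewrite -powR_mulrn ?ltW// -powRrM -(powR_inv1 (ltW e0)).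
  by congr (_ `^ _); field.
have dy : 2 <= d * y.
  rewrite leNgt; apply/negP => dy.
  have : (d * y) ^+ 3 < 2 ^+ 3 by rewrite ltrXn2r ?nnegrE// ?mulr_ge0 ?ltW.
  rewrite exprMn y3 ltr_pdivrMr// mulrC -ltr_pdivrMr ?exprn_gt0//.
  by rewrite -expr_div_n => /(lt_trans eps_small); rewrite ltxx.
pose n := Num.trunc (d * y).
have /andP[ny yn] : n%:R <= d * y < n.+1%:R by rewrite truncn_itv ?mulr_ge0 ?ltW.
have n0 : (0 < n)%N.
  by rewrite -(ltr_nat R) -(ltrD2r 1) natr1; move: yn dy; lra.
apply/ereal_infP => _ [T [A Aeps] <-]; rewrite lee_fin.
have nT : (n <= 32 * T)%N.
  apply: (adversary_bound (@hard_q_class R n n0) _ _ Aeps).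
  - by move=> x i t _; exact: hard_q_local.
  - by move=> i j t; exact: bump_supp_disjoint.
  move=> x i; apply: lt_le_trans (hard_q_gap R n0 x i).
  have n_pos : 0 < n%:R :> R by rewrite ltr0n.
  apply: (precision_bound e0 n_pos (d := d)).
  - rewrite mulrC -ler_pdivlMr// -y3 -exprMn lerXn2r ?nnegrE//.
    by rewrite mulr_ge0 ?ltW.
  - by rewrite /d; lra.
have : n%:R <= 32 * T%:R :> R by rewrite -natrM ler_nat.
by move: yn dy; rewrite -natr1; lra.
Unshelve. all: by end_near.
Qed.
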